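(* Let $B^1,\dots,B^r$ be processes on $[0,T]$ such that each $B^j$ is either a fractional Brownian motion with Hurst parameter $H_j>1/2$ or the identity function $B^j_t=t$, any two of them being either equal or independent (the distinct ones being mutually independent). Let $0=t_0<t_1<\cdots<t_n=T$ be a partition of $[0,T]$ and let $$\mathcal A=\bigcup_{k=0}^{n-1}[t_k,t_{k+1}]^r_<,\qquad\mathcal A'=\bigcup_{k=0}^{n-1}[t_k,t_{k+1}]^r.$$ With $\widetilde J_r(\mathcal B)=J_r(\mathcal B)-\mathbb E[J_r(\mathcal B)]$, we have $$\mathbb E\big(|\widetilde J_r(\mathcal A)|^2\big)\le\mathbb E\big(|\widetilde J_r(\mathcal A')|^2\big).$$
   Context: $[s,t]^r_<=\{(s_1,\dots,s_r)\in[0,T]^r:s\le s_1\le\cdots\le s_r\le t\}$. For a Borel set $\mathcal B\subset[0,T]^r$, $J_r(\mathcal B)=\int_0^T\cdots\int_0^T\mathbf 1_{\mathcal B}(s_1,\dots,s_r)\,dB^1_{s_1}\cdots dB^r_{s_r}$, whenever this exists as an iterated Riemann–Stieltjes integral defined by $L_p$-convergence of Riemann sums $\sum_kf_{u_k}(g_{u_{k+1}}-g_{u_k})$ for $L_p$-valued functions ($u_k=kT/l$, $l\to\infty$). A fractional Brownian motion of Hurst parameter $H\in(0,1)$ is a centered Gaussian process with covariance $\frac12(t^{2H}+s^{2H}-|t-s|^{2H})$. *)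

(* Defs.v *)
From HB Require Import structures.
From mathcomp Require Import all_boot all_order all_algebra.
From mathcomp Require Import all_classical all_reals all_analysis.

Set Implicit Arguments.
Unset Strict Implicit.
Unset Printing Implicit Defensive.

Import Order.TTheory GRing.Theory Num.Theory.
Import numFieldNormedType.Exports.

Local Open Scope classical_set_scope.
Local Open Scope ring_scope.

(* A process on [0, T] is a function [X : R -> Omega -> R], of which only the
   values at times of [0, T] are ever used. *)

(* [normal_prob m 0] is not the point mass at [m] in the library, so degenerate
   Gaussian laws are treated apart. *)
Definition gaussian_rv d (Omega : measurableType d) (R : realType)
    (P : probability Omega R) (X : Omega -> R) : Prop :=
  measurable_fun setT X /\
  exists m sigma : R, 0 <= sigma /\
    forall A : set R, measurable A ->
      P (X @^-1` A) = if sigma == 0 then \d_m A else normal_prob m sigma A.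

Definition gaussian_process d (Omega : measurableType d) (R : realType)
    (P : probability Omega R) (T : R) (X : R -> Omega -> R) : Prop :=
  forall (m : nat) (u a : 'I_m -> R), (forall i, u i \in `[0, T]) ->
    gaussian_rv P (fun w => \sum_(i < m) a i * X (u i) w).

Definition is_fBm d (Omega : measurableType d) (R : realType)
    (P : probability Omega R) (T H : R) (X : R -> Omega -> R) : Prop :=
  [/\ 0 < H < 1,
      gaussian_process P T X,
      (forall u : R, u \in `[0, T] -> ('E_P[X u] = 0)%E) &
      forall u v : R, u \in `[0, T] -> v \in `[0, T] ->
        covariance P (X u) (X v) =
        (2^-1 * (u `^ (2 * H) + v `^ (2 * H) - `|u - v| `^ (2 * H)))%:E].

Definition same_process (Omega : Type) (R : realType) (T : R)
    (X Y : R -> Omega -> R) : Prop :=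
  forall u : R, u \in `[0, T] -> X u = Y u.

Definition process_sigma d (Omega : measurableType d) (R : realType) (T : R)
    (X : R -> Omega -> R) : set (set Omega) :=
  <<s \bigcup_(u in `[0, T]) preimage_set_system setT (X u) measurable >>.

Definition mutually_independent d (Omega : measurableType d) (R : realType)
    (P : probability Omega R) (I : finType) (S : {set I})
    (F : I -> set (set Omega)) : Prop :=
  forall (J : {set I}) (E : I -> set Omega), J \subset S ->
    (forall i, i \in J -> F i (E i)) ->
    fine (P (\bigcap_(i in [set` J]) E i)) = \prod_(i in J) fine (P (E i)).

(* Two-element sets [S] give "any two are equal or independent"; general [S]
   give mutual independence of the distinct processes. *)
Definition equal_or_independent d (Omega : measurableType d) (R : realType)
    (P : probability Omega R) (T : R) (r : nat)
    (B : r.-tuple (R -> Omega -> R)) : Prop :=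
  forall S : {set 'I_r},
    (forall i j, i \in S -> j \in S -> i != j ->
       ~ same_process T (tnth B i) (tnth B j)) ->
    mutually_independent P S (fun i => process_sigma T (tnth B i)).

Definition RS_sum (Omega : Type) (R : realType) (T : R)
    (f g : R -> Omega -> R) (l : nat) (w : Omega) : R :=
  \sum_(k < l) f (k%:R * T / l%:R) w *
     (g (k.+1%:R * T / l%:R) w - g (k%:R * T / l%:R) w).

(* [I] is (a representative of) the integral of [f] against [g] over [0, T]. *)
Definition is_RS_integral d (Omega : measurableType d) (R : realType)
    (P : probability Omega R) (p T : R) (f g : R -> Omega -> R)
    (I : Omega -> R) : Prop :=
  [/\ (forall u : R, u \in `[0, T] -> f u \in Lfun P p%:E),
      (forall u : R, u \in `[0, T] -> g u \in Lfun P p%:E),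
      I \in Lfun P p%:E &
      ('N[P]_(p%:E)[EFin \o (RS_sum T f g l \- I)%R] @[l --> \oo] --> 0)%E].

(* The first variable is integrated first, against the first process, the
   other variables being fixed in [0, T]. *)
Fixpoint is_iterated_integral d (Omega : measurableType d) (R : realType)
    (P : probability Omega R) (p T : R) (r : nat) {struct r} :
    r.-tuple (R -> Omega -> R) -> (r.-tuple R -> Omega -> R) ->
    (Omega -> R) -> Prop :=
  match r with
  | 0 => fun _ F I => I = F [tuple]
  | r'.+1 => fun B F I =>
      exists G : r'.-tuple R -> Omega -> R,
        (forall s : r'.-tuple R, (forall i, tnth s i \in `[0, T]) ->
           is_RS_integral P p T (fun u => F [tuple of u :: s]) (thead B) (G s))
        /\ is_iterated_integral P p T [tuple of behead B] G I
  end.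

(* [J_r(A)] exists, in the sense of [L_p]-convergence, and equals [I]. *)
Definition is_J d (Omega : measurableType d) (R : realType)
    (P : probability Omega R) (p T : R) (r : nat)
    (B : r.-tuple (R -> Omega -> R)) (A : set (r.-tuple R))
    (I : Omega -> R) : Prop :=
  is_iterated_integral P p T B (fun s _ => \1_A s) I.

Definition centered d (Omega : measurableType d) (R : realType)
    (P : probability Omega R) (X : Omega -> R) : Omega -> R :=
  fun w => X w - fine ('E_P[X])%E.

Definition cube (R : realType) (r : nat) (a b : R) : set (r.-tuple R) :=
  [set s | forall i, tnth s i \in `[a, b]].

(* The path condition says a <= s_1 <= ... <= s_r <= b. *)
Definition simplex (R : realType) (T : R) (r : nat) (a b : R) :
    set (r.-tuple R) :=
  [set s | cube 0 T s /\ path <=%R a (rcons s b)].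

Definition simplex_union (R : realType) (T : R) (r n : nat) (t : nat -> R) :
    set (r.-tuple R) :=
  \bigcup_(k < n) simplex T (t k) (t k.+1).

Definition cube_union (R : realType) (r n : nat) (t : nat -> R) :
    set (r.-tuple R) :=
  \bigcup_(k < n) cube (t k) (t k.+1).

(* Main.v *)
Require Import Defs.
From HB Require Import structures.
From mathcomp Require Import all_boot all_order all_algebra.
From mathcomp Require Import all_classical all_reals all_analysis.
From mathcomp Require Import measurable_realfun zify ring lra.

Import Order.TTheory GRing.Theory Num.Theory.
Import numFieldNormedType.Exports.

Local Open Scope classical_set_scope.
Local Open Scope ring_scope.

(** The iterated Riemann sums of an indicator are combinations, with
coefficients 0 or 1, of products of increments of the processes.  All of the
proof rests on one positivity property of such products [X] and [Y]:

  E[X] >= 0   and   E[X Y] >= E[X] E[Y].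

Since the simplices lie in the cubes, the sums [S] for the simplices and [S']
for the cubes satisfy [S' = S + V], where [S] and [V] both are nonnegative
combinations of products of increments, and
Var S' = Var S + Var V + 2 Cov(S, V) >= Var S.

Positivity for one fractional Brownian motion of Hurst parameter above 1/2:
its increments are centered Gaussian with nonnegative covariances, because
|x|^(2H) is convex ([fBm_increment_cov_ge0]), and Gaussian integration by parts
([gaussian_prod_ibp]) writes E[Y X_1 ... X_n] as the sum over i of
E[Y X_i] E[prod_(j != i) X_j].  By induction all these moments are nonnegative.
When one splits the X_i into two blocks and Y belongs to the first one, the
terms with X_i in the first block reproduce the product of the expectations,
and the other ones only add to it ([gaussian_prod_cov_ge0]).  Integration by
parts itself comes from the recursion on the moments of the normal law, by
reading off the coefficient of e in the moments of Z + e X.  The increments of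
the identity are nonnegative constants.  For several processes, a product of
  increments is regrouped by distinct processes; its
expectation is the product over the groups, by independence, and inequalities
between nonnegative numbers multiply ([monomial_cov_ge0]).

To pass to the limit, let [C] be the set of the random variables which are
limits, in every L^q with q finite, of nonnegative combinations of products of
increments.  It is stable under sums and products, and positivity extends to
it.  Convergence of Riemann sums holds in L^p for one p only, possibly p = 1,
and the next integration multiplies the limit by increments, so it has to be
upgraded to all L^q.  Positivity does this: the increments over a subdivision
add up to the increment over [0, T], so that every sum is dominated, with
respect to the order defined by [C], by the product [M] of the total increments;
hence its moments are bounded by those of [M], and L^1 convergence with bounded
moments is convergence in all L^q ([cone_limit]).  An induction on the number of
integrations, in which [F], [F' - F] and [M - F'] stay in [C]
([cone_iterated_integral]), concludes. *)

Set Implicit Arguments.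
Unset Strict Implicit.
Unset Printing Implicit Defensive.

(** * Random variables with moments of all orders *)

Section Moments.
Context {d : measure_display} {Omega : measurableType d} {R : realType}.
Variable P : probability Omega R.
Implicit Types X Y Z : Omega -> R.

(** Real-valued, so that ring and order reasoning applies to expectations. *)
Definition mean X : R := \int[P]_w X w.

(** Unlike a single L^p space, this class is stable under products. *)
Definition all_moments X : Prop :=
  measurable_fun setT X /\
  forall k : nat, P.-integrable setT (EFin \o (X ^+ k)).

Lemma integrable_dominated X Y :
  measurable_fun setT X -> (forall w, `|X w| <= Y w) ->
  P.-integrable setT (EFin \o Y) -> P.-integrable setT (EFin \o X).
Proof.
move=> mX XY iY; apply: (le_integrable _ _ _ iY) => //=.
  exact/measurable_EFinP.
by move=> w _; rewrite lee_fin (le_trans (XY w))// ler_norm.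
Qed.

Lemma all_moments_integrable X : all_moments X ->
  P.-integrable setT (EFin \o X).
Proof. by move=> [_ /(_ 1%N)]. Qed.

Lemma all_moments_cst (c : R) : all_moments (cst c).
Proof.
split=> // k; rewrite (_ : cst c ^+ k = cst (c ^+ k)).
  exact: finite_measure_integrable_cst.
by apply/funext => w; rewrite exprfctE.
Qed.

Lemma all_moments0 : all_moments 0.
Proof. exact: all_moments_cst. Qed.

Lemma all_moments1 : all_moments 1.
Proof. exact: all_moments_cst. Qed.

Lemma measurable_exp X k : measurable_fun setT X ->
  measurable_fun setT (X ^+ k).
Proof. by move=> mX; rewrite exprfctE; exact: measurable_funX. Qed.

Lemma integrable_expD X Y k : all_moments X -> all_moments Y ->
  P.-integrable setT (EFin \o (fun w => 2 ^+ k * (`|X w| ^+ k + `|Y w| ^+ k))).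
Proof.
move=> [mX iX] [mY iY].
rewrite (_ : EFin \o _ = fun w => ((2 ^+ k)%:E *
  ((EFin \o (Num.norm \o (X ^+ k)%R)) w +
   (EFin \o (Num.norm \o (Y ^+ k)%R)) w))%E).
  apply: integrableZl => //; apply: integrableD => //.
  - exact: integrable_norm.
  - exact: integrable_norm.
by apply/funext => w; rewrite /= !exprfctE !normrX.
Qed.

(** The norm of a sum is at most twice the larger of the two norms. *)
Lemma exp_normD_le (x y : R) k :
  `|x + y| ^+ k <= 2 ^+ k * (`|x| ^+ k + `|y| ^+ k).
Proof.
wlog xy : x y / `|x| <= `|y|.
  move=> h; have [/h//|/ltW/h] := leP `|x| `|y|.
  by rewrite addrC [X in _ * X]addrC.
apply: (@le_trans _ _ ((2 * `|y|) ^+ k)).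
  apply: lerXn2r; rewrite ?nnegrE ?mulr_ge0//.
  by apply: (le_trans (ler_normD _ _)); lra.
by rewrite exprMn ler_wpM2l ?exprn_ge0// lerDr exprn_ge0.
Qed.

Lemma all_momentsD X Y : all_moments X -> all_moments Y -> all_moments (X + Y).
Proof.
move=> aX aY; have [[mX iX] [mY iY]] := (aX, aY).
have mXY : measurable_fun setT (X + Y) by exact: measurable_funD.
split=> // k; apply: integrable_dominated (integrable_expD k aX aY).
  exact: measurable_exp.
by move=> w; rewrite exprfctE normrX; exact: exp_normD_le.
Qed.

Lemma all_momentsM X Y : all_moments X -> all_moments Y -> all_moments (X * Y).
Proof.
move=> aX aY; have [[mX iX] [mY iY]] := (aX, aY).
have mXY : measurable_fun setT (X * Y) by exact: measurable_funM.
split=> // k; apply: integrable_dominated (integrable_expD k.*2 aX aY).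
  exact: measurable_exp.
move=> w; rewrite exprfctE normrX normrM exprMn.
rewrite -muln2 !exprM; set x := `|X w| ^+ k; set y := `|Y w| ^+ k.
have ? : 0 <= x by exact: exprn_ge0.
have ? : 0 <= y by exact: exprn_ge0.
set c := 2 ^+ k; have c1 : 1 <= c ^+ 2 by rewrite -exprM exprn_ege1// ler1n.
(* 2 x y <= x^2 + y^2 *)
apply: (@le_trans _ _ (x ^+ 2 + y ^+ 2)); first by nra.
by rewrite ler_peMl// addr_ge0// sqr_ge0.
Qed.

Lemma all_momentsZ (c : R) X : all_moments X -> all_moments (c *: X).
Proof. by move=> aX; exact: (all_momentsM (all_moments_cst c) aX). Qed.

Lemma all_momentsN X : all_moments X -> all_moments (- X).
Proof. by rewrite -scaleN1r; exact: all_momentsZ. Qed.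

Lemma all_momentsB X Y : all_moments X -> all_moments Y -> all_moments (X - Y).
Proof. by move=> aX aY; apply: all_momentsD => //; exact: all_momentsN. Qed.

Lemma all_moments_sum (I : Type) (s : seq I) (Q : pred I) (F : I -> Omega -> R)
  :
  (forall i, Q i -> all_moments (F i)) -> all_moments (\sum_(i <- s | Q i) F i).
Proof.
move=> aF; elim/big_ind : _ => //; [exact: all_moments0|exact: all_momentsD].
Qed.

Lemma all_moments_prod (I : Type) (s : seq I) (Q : pred I) (F : I -> Omega ->
  R) :
  (forall i, Q i -> all_moments (F i)) -> all_moments (\prod_(i <- s | Q i) F
    i).
Proof.
move=> aF; elim/big_ind : _ => //; [exact: all_moments1|exact: all_momentsM].
Qed.

Lemma all_momentsX X k : all_moments X -> all_moments (X ^+ k).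
Proof.
move=> aX; elim: k => [|k ih]; first exact: all_moments1.
by rewrite exprS; exact: all_momentsM.
Qed.

Lemma all_moments_norm X : all_moments X -> all_moments (fun w => `|X w|).
Proof.
move=> [mX iX]; have mn : measurable_fun setT (fun w => `|X w|).
  exact: measurableT_comp.
split=> // k; apply: (@integrable_dominated _ (Num.norm \o (X ^+ k))).
- exact: measurable_exp.
- by move=> w; rewrite /= !exprfctE !normrX normr_id.
- exact: integrable_norm.
Qed.

Lemma meanD X Y : all_moments X -> all_moments Y ->
  mean (X + Y) = mean X + mean Y.
Proof.
by move=> aX aY; rewrite /mean RintegralD//; exact: all_moments_integrable.
Qed.

Lemma meanZ (c : R) X : all_moments X -> mean (c *: X) = c * mean X.
Proof.
by move=> aX; rewrite /mean RintegralZl//; exact: all_moments_integrable.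
Qed.

Lemma meanN X : all_moments X -> mean (- X) = - mean X.
Proof. by move=> aX; rewrite -scaleN1r meanZ// mulN1r. Qed.

Lemma meanB X Y : all_moments X -> all_moments Y ->
  mean (X - Y) = mean X - mean Y.
Proof.
by move=> aX aY; rewrite meanD// ?meanN//; exact: all_momentsN.
Qed.

Lemma mean_cst (c : R) : mean (cst c) = c.
Proof. by rewrite /mean Rintegral_cst//
  [X in fine X]probability_setT mulr1. Qed.

Lemma mean_sum (I : Type) (s : seq I) (Q : pred I) (F : I -> Omega -> R) :
  (forall i, Q i -> all_moments (F i)) ->
  mean (\sum_(i <- s | Q i) F i) = \sum_(i <- s | Q i) mean (F i).
Proof.
move=> aF; elim: s => [|i s ih]; first by rewrite !big_nil; exact: mean_cst.
rewrite !big_cons; case: ifP => // Qi.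
by rewrite meanD ?ih//; [exact: aF|exact: all_moments_sum].
Qed.

Lemma mean_ge0 X : (forall w, 0 <= X w) -> 0 <= mean X.
Proof. by move=> X0; exact: Rintegral_ge0. Qed.

Lemma mean_le X Y : all_moments X -> all_moments Y ->
  (forall w, X w <= Y w) -> mean X <= mean Y.
Proof.
by move=> aX aY XY; apply: le_Rintegral => //; exact: all_moments_integrable.
Qed.

Lemma expectation_mean X : all_moments X -> ('E_P[X] = (mean X)%:E)%E.
Proof.
move=> aX; rewrite unlock /mean /Rintegral fineK//.
exact/integrable_fin_num/all_moments_integrable.
Qed.

End Moments.

(** * Densities and image measures *)

(** The setting covers the law of a random variable ([h = 1]), a law with
    density ([phi] the identity), and the restriction of a measure to a
    smaller sigma-algebra ([phi] the identity between two measurable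
    structures). *)
Section Density.
Context {d d' : measure_display} {T : measurableType d}
  {T' : measurableType d'} {R : realType}.
Variables (mu : {measure set T -> \bar R}) (nu : {measure set T' -> \bar R}).
Variables (phi : T -> T') (h : T -> R).
Hypotheses (mphi : measurable_fun setT phi) (mh : measurable_fun setT h).
Hypothesis h0 : forall x, 0 <= h x.
Hypothesis nuE : forall A, measurable A ->
  nu A = (\int[mu]_(x in phi @^-1` A) (h x)%:E)%E.

Import HBNNSimple.

Lemma integral_density_nnsfun (f : {nnsfun T' >-> R}) :
  (\int[nu]_x (f x)%:E = \int[mu]_x ((f (phi x))%:E * (h x)%:E))%E.
Proof.
under [LHS]eq_integral do rewrite fimfunE -fsumEFin//.
rewrite [LHS]ge0_integral_fsum//; last 2 first.
  - by move=> r; exact/measurable_EFinP/measurableT_comp.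
  - by move=> n x _; rewrite EFinM nnfun_muleindic_ge0.
under [RHS]eq_integral => x _.
  rewrite fimfunE -fsumEFin// ge0_mule_fsuml; last first.
    by move=> r; rewrite EFinM nnfun_muleindic_ge0.
  over.
have mi r : measurable_fun setT (fun x => \1_(f @^-1` [set r]) (phi x) : R).
  by apply: (measurableT_comp (f := \1_(f @^-1` [set r]) : T' -> R)).
rewrite [RHS]ge0_integral_fsum//; last 2 first.
  - move=> r; apply: emeasurable_funM; apply/measurable_EFinP => //.
    exact: measurable_funM.
  - by move=> r x _; rewrite mule_ge0 ?lee_fin//
    -lee_fin EFinM nnfun_muleindic_ge0.
apply: eq_fsbigr => r /set_mem [y _ <-].
under [LHS]eq_integral do rewrite EFinM.
rewrite ge0_integralZl//; last 2 first.
- exact/measurable_EFinP.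
- by rewrite lee_fin.
rewrite integral_indic// setIT nuE//.
under [RHS]eq_integral do rewrite EFinM -muleA.
rewrite ge0_integralZl//; last 3 first.
- by apply: emeasurable_funM; exact/measurable_EFinP.
- by move=> x _; rewrite mule_ge0// lee_fin.
- by rewrite lee_fin.
congr (_ * _)%E; rewrite integral_mkcond; apply: eq_integral => x _.
rewrite patchE indicE.
case: ifPn => hx; first by rewrite mem_set ?mul1e//; exact: set_mem hx.
rewrite memNset ?mul0e//.
by apply: contraNnot hx => hx; exact/mem_set.
Qed.

Lemma ge0_integral_density (f : T' -> \bar R) :
  measurable_fun setT f -> (forall x, 0 <= f x)%E ->
  (\int[nu]_x f x = \int[mu]_x (f (phi x) * (h x)%:E))%E.
Proof.
move=> mf f0; pose f_ := nnsfun_approx measurableT mf.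
have nd n m (x : T') : (n <= m)%N -> ((f_ n x)%:E <= (f_ m x)%:E)%E.
  by move=> nm; rewrite lee_fin; exact/lefP/nd_nnsfun_approx.
transitivity (limn (fun n => \int[nu]_x (f_ n x)%:E))%E.
  rewrite -monotone_convergence//=.
  - apply: eq_integral => x _; apply/esym/cvg_lim => //=.
    exact: cvg_nnsfun_approx.
  - by move=> n; exact/measurable_EFinP/measurable_funTS.
  - by move=> n ? _; rewrite lee_fin.
  - by move=> x _ n m; exact: nd.
under eq_fun do rewrite integral_density_nnsfun.
rewrite -monotone_convergence//=.
- apply: eq_integral => x _; apply/cvg_lim => //=.
  apply: cvgeZr => //; exact: cvg_nnsfun_approx.
- move=> n; apply: emeasurable_funM; apply/measurable_EFinP => //.
  exact: measurableT_comp.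
- by move=> n x _; rewrite mule_ge0 ?lee_fin.
- by move=> x _ n m nm; rewrite lee_wpmul2r ?lee_fin//; exact: nd.
Qed.

(** On both sides the integral is by definition the difference of the
    integrals of the positive and of the negative parts. *)
Lemma integral_density (f : T' -> \bar R) : measurable_fun setT f ->
  (\int[nu]_x f x = \int[mu]_x (f (phi x) * (h x)%:E))%E.
Proof.
move=> mf; rewrite integralE [RHS]integralE; congr (_ - _)%E.
- rewrite ge0_integral_density//; last exact: measurable_funepos.
  by apply: eq_integral => x _; rewrite !funeposE maxe_pMl ?lee_fin// mul0e.
- rewrite ge0_integral_density//; last exact: measurable_funeneg.
  by apply: eq_integral => x _;
    rewrite !funenegE maxe_pMl ?lee_fin// mul0e mulNe.
Qed.

End Density.

(** * Moments of the normal law *)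

Section FullLineFTC.
Context {R : realType}.
Local Notation leb := (@lebesgue_measure R).

(** The fundamental theorem of calculus on [c - n, c + n] leaves boundary
    terms of size at most 2 K / n. *)
Lemma integral_derivative_eq0 (F f : R -> R) (c K : R) :
  (forall x : R, is_derive x 1 F (f x)) -> continuous f ->
  leb.-integrable setT (EFin \o f) ->
  (forall x, `|x - c| * `|F x| <= K) ->
  (\int[leb]_x (f x)%:E = 0)%E.
Proof.
move=> dF cf fi FK.
pose a n := c - n.+1%:R; pose b n := c + n.+1%:R.
have ab n : a n < b n by rewrite /a /b ltrD2l gtrN.
pose f_ n : R -> \bar R := (EFin \o f) \_ `[a n, b n].
have intf n : (\int[leb]_x f_ n x = (F (b n) - F (a n))%:E)%E.
  rewrite /f_ -integral_mkcond (@continuous_FTC2 _ f F)//.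
  - exact: continuous_subspaceT.
  - have cF x : {for x, continuous F}.
      by apply/differentiable_continuous/derivable1_diffP; case: (dF x).
    split; first by move=> x _; case: (dF x).
    + by apply: cvg_at_right_filter; exact: cF.
    + by apply: cvg_at_left_filter; exact: cF.
  - by move=> x _; rewrite derive1E; exact: derive_val.
have mf : measurable_fun setT (EFin \o f) by exact: measurable_int fi.
have cvgf : (\int[leb]_x f_ n x @[n --> \oo] --> \int[leb]_x (EFin \o f) x)%E.
  apply: (@dominated_cvg _ _ _ leb setT measurableT f_ (EFin \o f)
    (fun x => `|(f x)%:E|%E)).
  - move=> n; rewrite /f_; apply/(measurable_restrictT (EFin \o f)) => //.
    exact: measurable_funTS.
  - move=> x _; apply: cvg_near_cst.
    near=> n; rewrite /f_ patchE mem_set//= in_itv/= /a /b.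
    have : `|x - c| <= n.+1%:R.
      rewrite (@le_trans _ _ n%:R) ?ler_nat//.
      by near: n; exact: nbhs_infty_ger.
    by rewrite ler_norml => /andP[]; lra.
  - by [].
  - exact: (integrable_norm fi).
  - by move=> n x _; rewrite /f_ patchE; case: ifP; rewrite ?abse0 ?abse_ge0.
have cvg0 : (\int[leb]_x f_ n x @[n --> \oo] --> 0%:E)%E.
  under eq_fun do rewrite intf.
  apply/fine_cvgP; split; first exact: nearW.
  rewrite (_ : fine \o _ = fun n => F (b n) - F (a n))//.
  apply/cvgr0Pnorm_le => e e0; near=> n.
  have n0 : 0 < n.+1%:R :> R by [].
  have FB x : `|x - c| = n.+1%:R -> `|F x| <= e / 2.
    move=> xc; have := FK x; rewrite xc => FKx.
    rewrite -(ler_pM2l n0) (le_trans FKx)//.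
    rewrite -ler_pdivrMr ?divr_gt0// (@le_trans _ _ n%:R) ?ler_nat//.
    by near: n; exact: nbhs_infty_ger.
  rewrite (le_trans (ler_normB _ _))// [leRHS]splitr lerD// FB//.
    by rewrite /b addrAC subrr add0r ger0_norm// ltW.
  by rewrite /a addrAC subrr add0r normrN ger0_norm// ltW.
exact: (cvg_unique _ cvgf cvg0).
Unshelve. all: by end_near.
Qed.

End FullLineFTC.

Section NormalMoments.
Context {R : realType}.
Variables (m s : R).
Hypothesis s0 : 0 < s.
Local Notation leb := (@lebesgue_measure R).
Local Notation N := (normal_prob m s).
Local Notation g := (normal_pdf m s).

Let sN0 : s != 0. Proof. by rewrite gt_eqF. Qed.

(** For |y| >= 1, one term of the exponential series dominates the power. *)
Lemma exp_norm_le_expR (k : nat) (a : R) : 0 < a ->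
  exists C : R, forall y : R, `|y| ^+ k <= C * expR (a * y ^+ 2).
Proof.
move=> a0; exists (1 + (k.+1)`!%:R / a ^+ k.+1) => y.
have u0 : 0 <= a * y ^+ 2 by rewrite mulr_ge0 ?sqr_ge0 ?ltW.
have e1 : 1 <= expR (a * y ^+ 2) by rewrite -expR0 ler_expR.
have f0 : 0 < (k.+1)`!%:R :> R by rewrite ltr0n fact_gt0.
have ek : (y ^+ 2) ^+ k.+1 <= (k.+1)`!%:R / a ^+ k.+1 * expR (a * y ^+ 2).
  have := expR_ge1Dxn k u0; rewrite exprMn => h.
  rewrite -ler_pdivrMl ?divr_gt0 ?exprn_gt0// invf_div.
  by rewrite (le_trans _ h)// mulrAC lerDr.
rewrite mulrDl mul1r; have [y1|y1] := leP `|y| 1.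
  rewrite (@le_trans _ _ 1) ?exprn_ile1// (le_trans e1)// lerDl.
  by rewrite mulr_ge0 ?expR_ge0// divr_ge0 ?exprn_ge0 ?ltW.
rewrite (@le_trans _ _ ((y ^+ 2) ^+ k.+1))//; last first.
  by rewrite (le_trans ek)// lerDr expR_ge0.
by rewrite -real_normK ?num_real// -exprM ler_weXn2l ?(ltW y1)//; lia.
Qed.

(** A part of the Gaussian decay absorbs the power: the density of standard
    deviation [2 * s] uses 1 / (8 s^2) of the rate 1 / (2 s^2), and the
    remaining 3 / (8 s^2) is left for the power. *)
Lemma normal_pdf_exp_le k : exists C : R, forall x,
  `|x - m| ^+ k * g x <= C * normal_pdf m (2 * s) x.
Proof.
have s20 : 2 * s != 0 by rewrite mulf_neq0.
have a0 : 0 < 3 / (8 * s ^+ 2) by rewrite divr_gt0// mulr_gt0// exprn_gt0.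
have [C hC] := exp_norm_le_expR k a0.
exists (C * normal_peak s / normal_peak (2 * s)) => x.
have p0 : normal_peak (2 * s) != 0 by rewrite gt_eqF// normal_peak_gt0.
rewrite !normal_pdfE//= [leRHS](_ : _ = normal_peak s *
    (C * normal_fun m (2 * s) x)); last by field.
rewrite mulrCA ler_wpM2l ?normal_peak_ge0// /normal_fun.
rewrite [X in _ * X <= _](_ : _ = expR (- (3 / (8 * s ^+ 2) * (x - m) ^+ 2)) *
    expR (- (x - m) ^+ 2 / ((2 * s) ^+ 2 *+ 2))); last first.
  by rewrite -expRD; congr expR; field.
rewrite mulrA ler_wpM2r ?expR_ge0//.
by rewrite expRN ler_pdivrMr ?expR_gt0.
Qed.

Lemma integrable_normal_pdf_exp k :
  leb.-integrable setT (EFin \o (fun x : R => (x - m) ^+ k * g x)).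
Proof.
have [C hC] := normal_pdf_exp_le k.
have mk : measurable_fun setT (fun x : R => (x - m) ^+ k * g x).
  apply: measurable_funM; last exact: measurable_normal_pdf.
  by apply: measurable_funX; exact: measurable_funB.
apply: (@le_integrable _ _ _ leb _ measurableT _
    (fun x : R => C%:E * (normal_pdf m (2 * s) x)%:E)%E).
- exact/measurable_EFinP.
- move=> x _ /=; rewrite lee_fin normrM normrX [`|g x|]ger0_norm.
    by rewrite (le_trans (hC x))// ler_norm.
  exact: normal_pdf_ge0.
- by apply: integrableZl => //; exact: integrable_normal_pdf.
Qed.

Lemma is_derive_normal_pdf_exp k (x : R) :
  is_derive x 1 (fun x : R => (x - m) ^+ k * g x)
    (k%:R * ((x - m) ^+ k.-1 * g x) - s ^- 2 * ((x - m) ^+ k.+1 * g x)).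
Proof.
have d0 : is_derive x 1 (fun x : R => x - m) 1 by exact: is_derive_shift.
have d1 : is_derive x 1 ((fun x : R => x - m) ^+ k) (k%:R * (x - m) ^+ k.-1).
  rewrite -[_ * _]mulr1; exact: (is_deriveX k d0).
have d2 : is_derive x 1 g (- (s ^- 2 * (x - m) * g x)).
  rewrite !normal_pdfE//.
  have dq : is_derive x 1 (fun x : R => - (x - m) ^+ 2 / (s ^+ 2 *+ 2))
      (- (s ^- 2 * (x - m))).
    rewrite (_ : (fun x : R => _) = - (s ^+ 2 *+ 2)^-1 *: (fun x : R =>
      x - m) ^+ 2).
      apply: is_derive_eq.
      by rewrite /GRing.scale/= mulr1 expr1; field.
    apply/funext => y; rewrite !fctE/GRing.scale/=.
    by rewrite mulrC mulNr mulrN.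
  have de : is_derive x 1 (normal_fun m s)
      (normal_fun m s x * - (s ^- 2 * (x - m))).
    exact: (@is_derive1_comp _ expR _ _ _ _ (is_derive_expR _) dq).
  rewrite (_ : (fun x : R => _) = normal_peak s *: normal_fun m s)//.
  apply: is_derive_eq; rewrite /GRing.scale/=; ring.
rewrite (_ : (fun x : R => _) = (fun x : R => x - m) ^+ k * g); last first.
  by rewrite !fctE.
apply: (is_derive_eq (is_deriveM d1 d2)).
rewrite /GRing.scale/= !exprfctE [X in _ = _ - _ * (X * _)]exprS; ring.
Qed.

(** The derivative of [(x - m) ^+ k * g x] has integral zero. *)
Lemma normal_pdf_moment_rec k :
  (\int[leb]_x ((x - m) ^+ k.+1 * g x)%:E =
   (k%:R * s ^+ 2)%:E * \int[leb]_x ((x - m) ^+ k.-1 * g x)%:E)%E.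
Proof.
pose f x := k%:R * ((x - m) ^+ k.-1 * g x) - s ^- 2 * ((x - m) ^+ k.+1 * g x).
have [C hC] := normal_pdf_exp_le k.+1.
pose M j := \int[leb]_x ((x - m) ^+ j * g x).
have ME j : (\int[leb]_x ((x - m) ^+ j * g x)%:E = (M j)%:E)%E.
  rewrite /M /Rintegral fineK//.
  exact/integrable_fin_num/integrable_normal_pdf_exp.
have i1 : leb.-integrable setT
    (EFin \o (fun x : R => k%:R * ((x - m) ^+ k.-1 * g x))).
  apply: (@integrableZl _ _ _ leb setT _ k%:R
    (EFin \o (fun x : R => (x - m) ^+ k.-1 * g x))) => //.
  exact: integrable_normal_pdf_exp.
have i2 : leb.-integrable setT
    (EFin \o (fun x : R => s ^- 2 * ((x - m) ^+ k.+1 * g x))).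
  apply: (@integrableZl _ _ _ leb setT _ (s ^- 2)
    (EFin \o (fun x : R => (x - m) ^+ k.+1 * g x))) => //.
  exact: integrable_normal_pdf_exp.
have cg j : continuous (fun x : R => (x - m) ^+ j * g x).
  move=> x; apply/differentiable_continuous/derivable1_diffP.
  by case: (is_derive_normal_pdf_exp j x).
(* Multiplying the primitive by |x - m| raises the exponent to k + 1. *)
have f0 : (\int[leb]_x (f x)%:E = 0)%E.
  apply: (@integral_derivative_eq0 _ (fun x : R => (x - m) ^+ k * g x) f m
      (`|C| * normal_peak (2 * s))).
  - by move=> x; exact: is_derive_normal_pdf_exp.
  - move=> x; apply: cvgB; apply: cvgM; try exact: cvg_cst; exact: cg.
  - exact: (integrableB measurableT i1 i2).
  - move=> x; rewrite normrM normrX [`|g x|]ger0_norm ?normal_pdf_ge0//.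
    rewrite mulrA -exprS (le_trans (hC x))//.
    rewrite (@le_trans _ _ (`|C| * normal_pdf m (2 * s) x))//.
      by rewrite ler_wpM2r ?normal_pdf_ge0 ?ler_norm.
    by rewrite ler_wpM2l// normal_pdf_ub// mulf_neq0.
have : \int[leb]_x f x = 0 by rewrite /Rintegral f0.
rewrite RintegralB// !RintegralZl//; try exact: integrable_normal_pdf_exp.
rewrite !ME -EFinM => /eqP; rewrite subr_eq0 => /eqP h; congr EFin.
rewrite mulrAC -/(M _) [k%:R * _]h; rewrite -/(M _); field.
by [].
Qed.

Lemma mean_normal (f : R -> R) : measurable_fun setT f ->
  mean N f = \int[leb]_x (f x * g x).
Proof.
move=> mf; rewrite /mean /Rintegral; congr fine.
rewrite (@integral_density _ _ _ _ _ leb N id g)//.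
- exact: measurable_normal_pdf.
- exact: normal_pdf_ge0.
- exact/measurable_EFinP.
Qed.

Lemma normal_centered_all_moments : all_moments N (fun x : R => x - m).
Proof.
split; first exact: measurable_funB.
move=> k; rewrite exprfctE.
have mk : measurable_fun setT (fun x : R => (x - m) ^+ k).
  by apply: measurable_funX; exact: measurable_funB.
apply/integrableP; split; first exact/measurable_EFinP.
rewrite (@integral_density _ _ _ _ _ leb N id g)//.
- have /integrableP[_] := integrable_normal_pdf_exp k.
  apply: le_lt_trans; rewrite le_eqVlt; apply/orP; left; apply/eqP.
  by apply: eq_integral => x _;
    rewrite /= normrM [`|g x|]ger0_norm ?normal_pdf_ge0.
- exact: measurable_normal_pdf.
- exact: normal_pdf_ge0.
- by apply: measurableT_comp => //; exact/measurable_EFinP.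
Qed.

Lemma normal_centered_moment_rec k :
  mean N ((fun x : R => x - m) ^+ k.+1) =
  k%:R * s ^+ 2 * mean N ((fun x : R => x - m) ^+ k.-1).
Proof.
have mk j : measurable_fun setT ((fun x : R => x - m) ^+ j).
  by rewrite exprfctE; apply: measurable_funX; exact: measurable_funB.
rewrite !mean_normal// !exprfctE /Rintegral normal_pdf_moment_rec fineM//.
exact/integrable_fin_num/integrable_normal_pdf_exp.
Qed.

End NormalMoments.

(** * Moments of Gaussian random variables *)

Section Law.
Context {d : measure_display} {Omega : measurableType d} {R : realType}.
Variables (P : probability Omega R) (nu : probability (measurableTypeR R) R).
Variable Z : Omega -> R.
Hypothesis mZ : measurable_fun setT Z.
Hypothesis lawZ : forall A : set R, measurable A -> P (Z @^-1` A) = nu A.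

Lemma integral_law (f : R -> \bar R) : measurable_fun setT f ->
  (\int[nu]_x f x = \int[P]_w f (Z w))%E.
Proof.
move=> mf; rewrite (@integral_density _ _ _ _ _ P nu Z (cst 1))//.
  by apply: eq_integral => w _; rewrite mule1.
move=> A mA; transitivity (P (Z @^-1` A)); first by rewrite lawZ.
have mA' : measurable (Z @^-1` A) by rewrite -[X in measurable X]setTI;
  exact: mZ.
by rewrite -[LHS]mul1e -(integral_cst P mA' 1%E).
Qed.

Lemma mean_law (f : R -> R) : measurable_fun setT f ->
  mean P (f \o Z) = mean nu f.
Proof.
by move=> mf; rewrite /mean /Rintegral integral_law//; exact/measurable_EFinP.
Qed.

Lemma all_moments_law (f : R -> R) : all_moments nu f ->
  all_moments P (f \o Z).
Proof.
move=> [mf fi]; split; first exact: measurableT_comp.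
move=> k; have /integrableP[mk ik] := fi k.
apply/integrableP; split.
  rewrite (_ : EFin \o _ = (EFin \o (f ^+ k)%R) \o Z); last first.
    by apply/funext => w; rewrite /= !exprfctE.
  exact: measurableT_comp.
move: ik; rewrite integral_law; last exact: measurableT_comp.
apply: le_lt_trans; rewrite le_eqVlt; apply/orP; left; apply/eqP.
by apply: eq_integral => w _; rewrite /= !exprfctE.
Qed.

End Law.

Section GaussianMoments.
Context {d : measure_display} {Omega : measurableType d} {R : realType}.
Variable P : probability Omega R.
Implicit Type Z : Omega -> R.

(** Degenerate laws, which are not given by a density, are kept apart: there
    all moments are powers of the mean. *)
Lemma gaussian_rvP Z : gaussian_rv P Z ->
  [\/ exists2 m : R, all_moments P Z & forall k, mean P (Z ^+ k) = m ^+ k |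
   exists m s : R, [/\ 0 < s, all_moments P Z &
     forall k, mean P ((Z - cst m) ^+ k) =
       mean (normal_prob m s) ((fun x : R => x - m) ^+ k)]].
Proof.
move=> [mZ [m [s [s0 law]]]]; have [s0'|sN0] := eqVneq s 0.
  left; exists m.
    rewrite (_ : Z = id \o Z)//;
      apply: (@all_moments_law _ _ _ _ (\d_(m : measurableTypeR R))) => //.
      by move=> A mA; rewrite law// s0' eqxx.
    split=> // k; apply/integrableP; split.
      by apply/measurable_EFinP; exact: measurable_exp.
    rewrite integral_dirac ?diracT ?mul1e ?ltry//.
    by apply: measurableT_comp => //; apply/measurable_EFinP;
      exact: measurable_exp.
  move=> k; rewrite (_ : Z ^+ k = (id ^+ k) \o Z); last first.
    by apply/funext => w; rewrite /= !exprfctE.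
  rewrite (@mean_law _ _ _ _ (\d_(m : measurableTypeR R))) //.
  - rewrite /mean /Rintegral integral_dirac//; last first.
      by apply/measurable_EFinP; exact: measurable_exp.
    by rewrite diracT mul1e/= exprfctE.
  - by move=> A mA; rewrite law// s0' eqxx.
  - exact: measurable_exp.
have {s0}s0 : 0 < s by rewrite lt_neqAle eq_sym sN0.
have lawN A : measurable A -> P (Z @^-1` A) = normal_prob m s A.
  by move=> mA; rewrite law// (negbTE sN0).
have am := normal_centered_all_moments m s0.
right; exists m, s; split=> //.
  rewrite (_ : Z = ((fun x : R => x - m) + cst m) \o Z); last first.
    by apply/funext => w; rewrite /= !fctE subrK.
  apply: (@all_moments_law _ _ _ _ (normal_prob m s) _ mZ lawN).
  by apply: all_momentsD => //; exact: all_moments_cst.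
move=> k; rewrite -(@mean_law _ _ _ _ (normal_prob m s) _ mZ lawN);
  last by apply: measurable_exp; case: am.
by congr mean; apply/funext => w; rewrite /= !fctE.
Qed.

Lemma gaussian_all_moments Z : gaussian_rv P Z -> all_moments P Z.
Proof. by case/gaussian_rvP => [[m]//|[m [s []]]]. Qed.

(** The recursion for the normal law, with the variance expressed as a moment
    so that it also covers degenerate laws. *)
Lemma gaussian_moment_rec Z (k : nat) : gaussian_rv P Z -> mean P Z = 0 ->
  mean P (Z ^+ k.+2) = k.+1%:R * mean P (Z ^+ 2) * mean P (Z ^+ k).
Proof.
case/gaussian_rvP => [[m aZ ZE]|[m [s [s0 aZ ZE]]]] Z0.
  have m0 : m = 0 by rewrite -[m]expr1 -ZE.
  by rewrite !ZE m0 !expr0n/= mulr0 mul0r.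
have mZ : m = 0.
  have := normal_centered_moment_rec m s0 0.
  rewrite !mul0r -ZE expr1 meanB//; last exact: all_moments_cst.
  by rewrite Z0 mean_cst sub0r => /eqP; rewrite oppr_eq0 => /eqP.
have Zc : Z - cst m = Z by rewrite mZ; exact: subr0.
rewrite Zc in ZE; rewrite !ZE !(normal_centered_moment_rec m s0)/= mul1r.
by rewrite expr0 [mean _ 1]mean_cst mulr1.
Qed.

End GaussianMoments.

(** * Gaussian integration by parts and positivity *)

Section PolyCoef.
Context {R : numDomainType}.

Lemma horner_inj (p q : {poly R}) : (forall x, p.[x] = q.[x]) -> p = q.
Proof.
move=> pq; apply/eqP; rewrite -subr_eq0; apply: contraT => d0.
have := @max_poly_roots _ (p - q) [seq i%:R | i <- iota 0 (size (p - q))] d0.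
rewrite size_map size_iota ltnn; apply.
  by apply/allP => x _; rewrite /root hornerD hornerN pq subrr.
by rewrite map_inj_uniq ?iota_uniq//; exact: mulrIn (oner_neq0 R).
Qed.

End PolyCoef.

Section LinearFunctionals.
Context {d : measure_display} {Omega : measurableType d} {R : realType}.
Variable P : probability Omega R.
Implicit Types (X Y Z : Omega -> R) (l : (Omega -> R) -> R).

(** Linearity is only asked on [all_moments], where all the expectations
    involved are finite. *)
Definition linear_on_moments l : Prop :=
  (forall X Y, all_moments P X -> all_moments P Y -> l (X + Y) = l X + l Y) /\
  (forall (c : R) X, all_moments P X -> l (c *: X) = c * l X).

Lemma linear_on_moments_sum l (I : Type) (s : seq I) (F : I -> Omega -> R) :
  linear_on_moments l -> (forall i, all_moments P (F i)) ->
  l (\sum_(i <- s) F i) = \sum_(i <- s) l (F i).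
Proof.
move=> [lD lZ] aF; elim: s => [|i s ih].
  by rewrite !big_nil -(scale0r 0) lZ ?mul0r//; exact: all_moments0.
by rewrite !big_cons lD ?ih//; exact: all_moments_sum.
Qed.

(** The expansion of [l ((Z + e *: Y) ^+ n)] in powers of [e]. *)
Definition pencil_poly l Z Y (n : nat) : {poly R} :=
  \poly_(i < n.+1) (l (Z ^+ (n - i) * Y ^+ i) *+ 'C(n, i)).

Lemma pencil_polyE l Z Y n (e : R) : linear_on_moments l ->
  all_moments P Z -> all_moments P Y ->
  l ((Z + e *: Y) ^+ n) = (pencil_poly l Z Y n).[e].
Proof.
move=> ll aZ aY; rewrite exprDn linear_on_moments_sum//; last first.
  move=> i; rewrite -scaler_nat; apply: all_momentsZ.
  by apply: all_momentsM; apply: all_momentsX => //; exact: all_momentsZ.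
rewrite horner_poly; apply: eq_bigr => i _.
rewrite [X in l X](_ : _ = ('C(n, i)%:R * e ^+ i) *: (Z ^+ (n - i) * Y ^+ i)).
  rewrite (proj2 ll); first by rewrite -[in RHS]mulr_natl [RHS]mulrAC.
  by apply: all_momentsM; exact: all_momentsX.
rewrite -scaler_nat; apply/funext => w; rewrite !fctE /GRing.scale/= exprMn.
by rewrite -[RHS]mulrA; congr (_ * _); rewrite mulrCA.
Qed.

Lemma pencil_poly_coef0 l Z Y n : (pencil_poly l Z Y n)`_0 = l (Z ^+ n).
Proof. by rewrite coef_poly/= subn0 expr0 mulr1 bin0. Qed.

Lemma pencil_poly_coef1 l Z Y n :
  (pencil_poly l Z Y n)`_1 = n%:R * l (Z ^+ n.-1 * Y).
Proof.
rewrite coef_poly; case: n => [|n]; first by rewrite mul0r.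
by rewrite /= subn1 expr1 bin1 mulr_natl.
Qed.

Lemma linear_mean_mul X : all_moments P X ->
  linear_on_moments (fun U => mean P (U * X)).
Proof.
move=> aX; split=> [U V aU aV|c U aU].
  by rewrite mulrDl meanD//; exact: all_momentsM.
rewrite (_ : _ * X = c *: (U * X)) ?meanZ//; first exact: all_momentsM.
by apply/funext => w; rewrite !fctE /GRing.scale/= mulrA.
Qed.

Lemma linear_mean : linear_on_moments (mean P).
Proof. by split=> [U V aU aV|c U aU]; [exact: meanD|exact: meanZ]. Qed.

End LinearFunctionals.

Section Wick.
Context {d : measure_display} {Omega : measurableType d} {R : realType}.
Variable P : probability Omega R.
Variable L : set (Omega -> R).
Hypothesis LD : forall (e : R) X Y, L X -> L Y -> L (X + e *: Y).
Hypothesis LG : forall X, L X -> gaussian_rv P X /\ mean P X = 0.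
Local Notation E := (mean P).

Let La X : L X -> all_moments P X.
Proof. by move=> /LG[/gaussian_all_moments]. Qed.

(** Both sides of the moment recursion for [Z + e *: Y], which is Gaussian for
    every [e], are polynomials in [e]; the coefficients of degree one are
    compared, by induction on the exponent. *)
Lemma gaussian_pow_ibp n Y Z : L Y -> L Z ->
  E (Z ^+ n * Y) = n%:R * E (Y * Z) * E (Z ^+ n.-1).
Proof.
move=> LY LZ; have [aY aZ] := (La LY, La LZ).
elim: n {-2}n (leqnn n) => [|k ih] n.
  by rewrite leqn0 => /eqP->; rewrite expr0 mul1r !mul0r; case: (LG LY).
case: n => [_|n]; first exact: ih.
rewrite ltnS => nk.
have idp e : (pencil_poly E Z Y n.+2).[e] =
    (n.+1%:R *: (pencil_poly E Z Y 2 * pencil_poly E Z Y n)).[e].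
  have LZY : L (Z + e *: Y) by exact: LD.
  rewrite hornerZ hornerM -!(pencil_polyE _ _ (linear_mean P))//.
  by rewrite mulrA; have [gZ z0] := LG LZY; exact: gaussian_moment_rec.
have /(congr1 (fun p : {poly R} => p`_1)) := horner_inj idp.
rewrite coefZ coefM big_ord_recr big_ord1/= !pencil_poly_coef0
  !pencil_poly_coef1.
have e2 : n.+2%:R != 0 :> R by rewrite pnatr_eq0.
rewrite /= expr1 [Z * Y]mulrC => h; apply: (mulfI e2); rewrite h => {h}.
have rec : E (Z ^+ 2) * (n%:R * E (Z ^+ n.-1 * Y)) =
   n%:R * E (Y * Z) * E (Z ^+ n).
  case: n nk {idp e2} => [|[|n]] nk; first by rewrite !mul0r mulr0.
    by rewrite expr0 !mul1r (proj2 (LG LY)) expr1 (proj2 (LG LZ)) !mulr0.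
  rewrite (gaussian_moment_rec n (proj1 (LG LZ)) (proj2 (LG LZ)))/= ih ?(ltnW
    nk)//=.
  ring.
rewrite rec -[n.+2]addn2 -[n.+1]addn1 !natrD; ring.
Qed.


Context {I : Type}.
Variable X : I -> Omega -> R.
Hypothesis LX : forall i, L (X i).

Local Notation prodX s := (\prod_(i <- s) X i).

Let aX i : all_moments P (X i). Proof. exact/La/LX. Qed.

Let aprod s : all_moments P (prodX s).
Proof. exact: all_moments_prod. Qed.

(** All the contractions of [Y] with one factor of the product along [s]; [U]
    accumulates the factors already passed. *)
Fixpoint contraction_sum (Y U : Omega -> R) (s : seq I) : R :=
  if s is i :: s' then
    E (Y * X i) * E (U * prodX s') + contraction_sum Y (U * X i) s'
  else 0.

Lemma linear_contraction_sum Y s :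
  linear_on_moments P (fun U => contraction_sum Y U s).
Proof.
elim: s => [|i s [ihD ihZ]]; first by split=> *; rewrite ?addr0 ?mulr0.
have [mD mZ] := linear_mean_mul (aprod s).
have [iD iZ] : linear_on_moments P (fun U => contraction_sum Y (U * X i) s).
  split=> [U V aU aV|c U aU].
    by rewrite mulrDl ihD//; exact: all_momentsM.
  rewrite (_ : _ * X i = c *: (U * X i)) ?ihZ//; first exact: all_momentsM.
  by apply/funext => w; rewrite !fctE /GRing.scale/= mulrA.
split=> [U V aU aV|c U aU] /=; first by rewrite mD// iD//; ring.
by rewrite mZ// iZ//; ring.
Qed.

(** Polarization: one more factor [X i] is split off a power of [Z] by
    replacing [Z] with [Z + e *: X i] and reading off the coefficient of [e].
    All the terms are linear in the remaining factors, which is why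
    [contraction_sum] is kept as a linear functional of its argument [U]. *)
Lemma gaussian_pow_prod_ibp n Y Z s : L Y -> L Z ->
  E (Z ^+ n * prodX s * Y) = n%:R * E (Y * Z) * E (Z ^+ n.-1 * prodX s)
    + contraction_sum Y (Z ^+ n) s.
Proof.
move=> LY; have aY := La LY.
elim: s n Z => [|i s ih] n Z LZ; have aZ := La LZ.
  by rewrite big_nil !mulr1/= addr0; exact: gaussian_pow_ibp.
pose l1 U := E (U * (prodX s * Y)); pose l2 U := E (U * prodX s).
pose l3 U := contraction_sum Y U s.
have ll1 : linear_on_moments P l1.
  by apply: linear_mean_mul; exact: all_momentsM.
have ll2 : linear_on_moments P l2 by exact: linear_mean_mul.
have ll3 : linear_on_moments P l3 by exact: linear_contraction_sum.
have idp e : (pencil_poly l1 Z (X i) n.+1).[e] =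
    (n.+1%:R *: (((E (Y * Z))%:P + E (Y * X i) *: 'X) * pencil_poly l2 Z (X i)
      n)
      + pencil_poly l3 Z (X i) n.+1).[e].
  have LZX : L (Z + e *: X i) by exact: LD.
  rewrite hornerD hornerZ hornerM -!(@pencil_polyE _ _ _ P)//.
  rewrite /l1 mulrA ih//= -/(l2 _) -/(l3 _) !hornerE.
  have -> : E (Y * (Z + e *: X i)) = E (Y * Z) + E (Y * X i) * e.
    have [mD mZ] := linear_mean_mul aY.
    rewrite mulrC mD//; last exact: all_momentsZ.
    by rewrite mZ// [_ * Y]mulrC [X i * Y]mulrC [e * _]mulrC.
  by [].
have /(congr1 (fun p : {poly R} => p`_1)) := horner_inj idp.
rewrite coefD coefZ coefM big_ord_recr big_ord1/=.
rewrite !pencil_poly_coef0 !pencil_poly_coef1/=.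
rewrite !coefD !coefC !coefZ !coefX/= mulr0 mulr1 addr0 add0r.
rewrite /l1 /l2 /l3 big_cons => h.
have e1 : n.+1%:R != 0 :> R by rewrite pnatr_eq0.
apply: (mulfI e1); rewrite !mulrA in h *; rewrite h.
ring.
Qed.

(** The recursion behind the formula of Isserlis and Wick. *)
Lemma gaussian_prod_ibp Y s : L Y ->
  E (Y * prodX s) = contraction_sum Y 1 s.
Proof.
move=> LY; have := gaussian_pow_prod_ibp 0 s LY LY.
by rewrite expr0 mul1r !mul0r add0r mulrC.
Qed.

Hypothesis Xcov : forall i j, 0 <= E (X i * X j).

Lemma contraction_sum_ge0 i u s :
  (forall v, (size v < size u + size s)%N -> 0 <= E (prodX v)) ->
  0 <= contraction_sum (X i) (prodX u) s.
Proof.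
elim: s u => [|j s ih] u hE //=; apply: addr_ge0.
  by rewrite mulr_ge0// -big_cat/= hE// size_cat/= addnS.
have -> : prodX u * X j = prodX (j :: u) by rewrite big_cons mulrC.
apply: ih => v /= hv; apply: hE.
by rewrite /= addnS -addSn.
Qed.

Lemma gaussian_prod_ge0 s : 0 <= E (prodX s).
Proof.
elim: {s}_.+1 {-2}s (ltnSn (size s)) => // n ih s; rewrite ltnS => sn.
case: s sn => [_|i s sn]; first by rewrite big_nil [E 1]mean_cst.
rewrite big_cons gaussian_prod_ibp//.
rewrite -(big_nil 1 *%R xpredT X); apply: contraction_sum_ge0 => v /= vs.
by apply: ih; rewrite (leq_trans vs)// ltnW.
Qed.

(** The contractions of [X i] inside [s] reproduce, by induction, the product
    of the expectations; those with [t] are nonnegative. *)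
Lemma contraction_sum_cat_ge i u s t :
  (forall v, (size v < size u + size s)%N ->
     E (prodX v) * E (prodX t) <= E (prodX v * prodX t)) ->
  contraction_sum (X i) (prodX u) s * E (prodX t) <=
  contraction_sum (X i) (prodX u) (s ++ t).
Proof.
elim: s u => [|j s ih] u hE /=.
  rewrite mul0r; apply: contraction_sum_ge0 => v _; exact: gaussian_prod_ge0.
rewrite mulrDl; apply: lerD.
  rewrite -mulrA ler_wpM2l// big_cat/= mulrA -big_cat/=.
  by rewrite hE// size_cat/= addnS.
have -> : prodX u * X j = prodX (j :: u) by rewrite big_cons mulrC.
apply: ih => v /= hv; apply: hE.
by rewrite /= addnS -addSn.
Qed.

(** Pairings that do not mix [s] and [t] make up the product of the
    expectations, and mixed pairings contribute nonnegatively. *)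
Lemma gaussian_prod_cov_ge0 s t :
  E (prodX s) * E (prodX t) <= E (prodX s * prodX t).
Proof.
elim: {s}_.+1 {-2}s (ltnSn (size s)) => // n ih s; rewrite ltnS => sn.
case: s sn => [_|i s sn]; first by rewrite big_nil [E 1]mean_cst !mul1r.
rewrite -big_cat/= !big_cons !gaussian_prod_ibp//.
have := @contraction_sum_cat_ge i [::] s t; rewrite big_nil; apply => v /= vs.
by apply: ih; rewrite (leq_trans vs)// ltnW.
Qed.

End Wick.

(** * Increments of fractional Brownian motion *)

Section ConvexPower.
Context {R : realType}.

Lemma convex_norm_powR (p k x y : R) : 1 <= p -> 0 <= k <= 1 ->
  `|k * x + (1 - k) * y| `^ p <= k * `|x| `^ p + (1 - k) * `|y| `^ p.
Proof.
move=> p1 /andP[k0 k1]; have l0 : 0 <= 1 - k by rewrite subr_ge0.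
have kxy : `|k * x + (1 - k) * y| <= k * `|x| + (1 - k) * `|y|.
  by rewrite (le_trans (ler_normD _ _))// !normrM (ger0_norm k0) (ger0_norm l0).
have p0 : 0 <= p by exact: le_trans p1.
rewrite (@le_trans _ _ ((k * `|x| + (1 - k) * `|y|) `^ p))//.
  by apply: ge0_ler_powR; rewrite ?nnegrE// addr_ge0// mulr_ge0.
have := @convex_powR R p p1 (Itv01 k0 k1) `|x| `|y|.
by rewrite !inE/= !in_itv/= !andbT !normr_ge0; apply.
Qed.

(** The two inner points are convex combinations of the outer ones with
    exchanged weights. *)
Lemma norm_powR_majorization (p x y z t : R) : 1 <= p ->
  x <= y -> x <= z -> x + t = y + z ->
  `|y| `^ p + `|z| `^ p <= `|x| `^ p + `|t| `^ p.
Proof.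
move=> p1 xy xz e; have [xt|xt] := eqVneq x t.
  have -> : y = x by lra.
  by have -> : z = t by lra.
have tx : 0 < t - x by rewrite subr_gt0 lt_neqAle xt/=; lra.
pose k := (t - y) / (t - x).
have k01 : 0 <= k <= 1.
  rewrite divr_ge0 ?ler_pdivrMr ?mul1r//=; lra.
have k01' : 0 <= 1 - k <= 1 by lra.
have -> : y = k * x + (1 - k) * t by rewrite /k; field; lra.
have -> : z = (1 - k) * x + (1 - (1 - k)) * t.
  have -> : z = x + t - y by lra.
  by rewrite /k; field; lra.
have := lerD (convex_norm_powR x t p1 k01) (convex_norm_powR x t p1 k01').
lra.
Qed.

End ConvexPower.

Section Increments.
Context {R : realType}.

Definition subinterval (T : R) : Type :=
  {uv : R * R | [&& 0 <= uv.1, uv.1 <= uv.2 & uv.2 <= T]}.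

Definition lower T (i : subinterval T) : R := (val i).1.
Definition upper T (i : subinterval T) : R := (val i).2.

HB.instance Definition _ T := Choice.on (subinterval T).

Lemma subinterval_order T (i : subinterval T) :
  [&& 0 <= lower i, lower i <= upper i & upper i <= T].
Proof. exact: (valP i). Qed.

Lemma lower_itv T (i : subinterval T) : lower i \in `[0, T].
Proof. by have /and3P[? ? ?] := subinterval_order i; rewrite in_itv/=; lra. Qed.

Lemma upper_itv T (i : subinterval T) : upper i \in `[0, T].
Proof. by have /and3P[? ? ?] := subinterval_order i; rewrite in_itv/=; lra. Qed.

Definition increment (Omega : Type) (T : R) (X : R -> Omega -> R)
  (i : subinterval T) : Omega -> R := X (upper i) - X (lower i).

End Increments.

Section FractionalIncrements.
Context {d : measure_display} {Omega : measurableType d} {R : realType}.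
Variables (P : probability Omega R) (T H : R) (X : R -> Omega -> R).
Hypothesis fX : is_fBm P T H X.

(** The linear combinations are what the definition of a Gaussian process
    speaks of; they are the space in which Gaussian integration by parts takes
    place. *)
Definition linear_span : set (Omega -> R) :=
  [set Z | exists (m : nat) (u a : 'I_m -> R), (forall i, u i \in `[0, T]) /\
     Z = \sum_(i < m) a i *: X (u i)].

Lemma linear_span_mem u : u \in `[0, T] -> linear_span (X u).
Proof.
move=> uT; exists 1%N, (fun=> u), (fun=> 1); split=> //.
by rewrite big_ord1 scale1r.
Qed.

Lemma linear_spanD (e : R) (Y Z : Omega -> R) :
  linear_span Y -> linear_span Z -> linear_span (Y + e *: Z).
Proof.
move=> [m [u [a [uT ->]]]] [m' [u' [a' [uT' ->]]]].
exists (m + m')%N,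
  (fun i : 'I_(m + m') => match fintype.split i with inl i => u i | inr i =>
    u' i end),
  (fun i : 'I_(m + m') => match fintype.split i with inl i => a i | inr i =>
    e * a' i end).
split; first by move=> i; case: fintype.split.
rewrite big_split_ord/=; congr (_ + _).
  by apply: eq_bigr => i _; rewrite (unsplitK (inl i)).
rewrite scaler_sumr; apply: eq_bigr => i _.
by rewrite (unsplitK (inr i)) scalerA.
Qed.

Lemma linear_span_gaussian_rv Z : linear_span Z -> gaussian_rv P Z.
Proof.
move=> [m [u [a [uT ->]]]]; have [_ gX _ _] := fX.
rewrite (_ : \sum_(i < m) _ = fun w => \sum_(i < m) a i * X (u i) w).
  exact: gX.
by apply/funext => w; rewrite fct_sumE.
Qed.

Let aX u : u \in `[0, T] -> all_moments P (X u).
Proof.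
by move=> uT; exact/gaussian_all_moments/linear_span_gaussian_rv/linear_span_mem.
Qed.

Let mX u : u \in `[0, T] -> mean P (X u) = 0.
Proof.
move=> uT; have [_ _ + _] := fX => /(_ u uT); rewrite expectation_mean;
  last exact: aX.
by case.
Qed.

Lemma linear_span_centered Z : linear_span Z -> mean P Z = 0.
Proof.
move=> [m [u [a [uT ->]]]]; rewrite mean_sum; last first.
  by move=> i _; exact/all_momentsZ/aX.
by rewrite big1// => i _; rewrite meanZ ?mX ?mulr0//; exact: aX.
Qed.

Lemma fBm_mean_mul u v : u \in `[0, T] -> v \in `[0, T] ->
  mean P (X u * X v) =
  2^-1 * (u `^ (2 * H) + v `^ (2 * H) - `|u - v| `^ (2 * H)).
Proof.
move=> uT vT; have [_ _ EX /(_ u v uT vT)] := fX.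
rewrite covariance.unlock !EX//=.
rewrite (_ : (_ \- _) * _ = X u * X v).
  rewrite expectation_mean; first by case.
  by apply: all_momentsM; exact: aX.
by apply/funext => w; rewrite !fctE/= !subr0.
Qed.

(** The covariance is half a second difference of |x|^(2H), at four points to
    which [norm_powR_majorization] applies. *)
Lemma fBm_increment_cov_ge0 (i j : subinterval T) : 2^-1 < H ->
  0 <= mean P (increment X i * increment X j).
Proof.
move=> H2; have [[[li ui] lj] uj] :=
  (lower_itv i, upper_itv i, lower_itv j, upper_itv j).
rewrite /increment (_ : _ * _ = X (upper i) * X (upper j)
    - X (upper i) * X (lower j) - X (lower i) * X (upper j)
    + X (lower i) * X (lower j)); last by ring.
have am u v : u \in `[0, T] -> v \in `[0, T] -> all_moments P (X u * X v).
  by move=> uT vT; apply: all_momentsM; exact: aX.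
rewrite meanD ?meanB//; try (by repeat
  (apply: all_momentsB || apply: all_momentsD || exact: am)).
rewrite !fBm_mean_mul//.
have p1 : 1 <= 2 * H by lra.
have /and3P[_ ile _] := subinterval_order i.
have /and3P[_ jle _] := subinterval_order j.
have := @norm_powR_majorization _ (2 * H) (lower i - upper j)
  (upper i - upper j) (lower i - lower j) (upper i - lower j) p1.
by move=> /(_ _ _ _)/wrap[|||]; lra.
Qed.

Local Notation incr s := (\prod_(i <- s) increment X i).

Lemma increment_span (i : subinterval T) : linear_span (increment X i).
Proof.
rewrite /increment -scaleN1r; apply: linear_spanD; apply: linear_span_mem.
  exact: upper_itv.
exact: lower_itv.
Qed.

Let LG Z : linear_span Z -> gaussian_rv P Z /\ mean P Z = 0.
Proof.
by move=> LZ; split; [exact: linear_span_gaussian_rv|exact: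
  linear_span_centered].
Qed.

Lemma fBm_increment_all_moments (i : subinterval T) :
  all_moments P (increment X i).
Proof. exact/gaussian_all_moments/linear_span_gaussian_rv/increment_span. Qed.

Lemma fBm_prod_ge0 (s : seq (subinterval T)) : 2^-1 < H -> 0 <= mean P (incr s).
Proof.
move=> H2; apply: (gaussian_prod_ge0 linear_spanD LG increment_span) => i j.
exact: fBm_increment_cov_ge0.
Qed.

Lemma fBm_prod_cov_ge0 (s t : seq (subinterval T)) : 2^-1 < H ->
  mean P (incr s) * mean P (incr t) <= mean P (incr s * incr t).
Proof.
move=> H2; apply: (gaussian_prod_cov_ge0 linear_spanD LG increment_span) => i j.
exact: fBm_increment_cov_ge0.
Qed.

End FractionalIncrements.

(** * Products of independent factors *)

Section Independence.
Context {d : measure_display} {Omega : measurableType d} {R : realType}.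
Variable P : probability Omega R.

Lemma mean_indic (A : set Omega) : measurable A -> mean P (\1_A) = fine (P A).
Proof. by move=> mA; rewrite /mean /Rintegral integral_indic// setIT. Qed.

Lemma all_moments_indic (A : set Omega) : measurable A -> all_moments P (\1_A).
Proof.
move=> mA; have mi : measurable_fun setT (\1_A : Omega -> R).
  exact: measurable_indic.
split=> // k.
apply: (@integrable_dominated _ _ _ _ _ (cst 1)); first exact: measurable_exp.
  move=> w; rewrite exprfctE normrX exprn_ile1//.
  by rewrite indicE; case: (_ \in _); rewrite ?normr1 ?normr0.
exact: finite_measure_integrable_cst.
Qed.

Section FrozenFactor.
Variable G : set (set Omega).
Hypothesis Gmeas : <<s G >> `<=` measurable.

(** Both sides are the integral of [f] against the measure [c * P] on the
    sigma-algebra generated by [G]: on that sigma-algebra [H] is a density of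
    it, and so is the constant [c]. *)
Lemma integral_mul_independent (H : Omega -> R) (c : R) (f : Omega -> \bar R) :
  measurable_fun setT H -> (forall w, 0 <= H w) -> 0 <= c ->
  (forall A, <<s G >> A -> (\int[P]_(w in A) (H w)%:E = c%:E * P A)%E) ->
  measurable_fun setT (f : g_sigma_algebraType G -> \bar R) ->
  (\int[P]_w (f w * (H w)%:E) = \int[P]_w (f w * c%:E))%E.
Proof.
move=> mH H0 c0 hA mf.
pose phi : Omega -> g_sigma_algebraType G := id.
have mphi : measurable_fun setT phi.
  by move=> _ A mA; rewrite setTI; apply: Gmeas.
pose nu := mscale (NngNum c0) (distribution P (mfun_Sub (mem_set mphi))).
have nuE A : measurable (A : set (g_sigma_algebraType G)) ->
    nu A = (c%:E * P A)%E by [].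
rewrite -(@integral_density _ _ _ _ _ P nu phi H)//; last first.
  by move=> A mA; rewrite hA//; exact: nuE.
rewrite (@integral_density _ _ _ _ _ P nu phi (cst c))//.
move=> A mA; transitivity (c%:E * P A)%E; first exact: nuE.
by rewrite -(integral_cst P (Gmeas mA) c%:E).
Qed.

End FrozenFactor.

Context {I : finType}.
Variables (G : I -> set (set Omega)) (J : {set I}).
Hypothesis Gmeas : forall i, i \in J -> <<s G i >> `<=` measurable.
Hypothesis indep : mutually_independent P J (fun i => <<s G i >>).

Definition adapted (i : I) (h : Omega -> R) : Prop :=
  measurable_fun setT (h : g_sigma_algebraType (G i) -> R) /\ all_moments P h.

Local Notation upd h k g := (fun i => if i == k then g else h i).

Let prod_upd (h : I -> Omega -> R) k g : k \in J ->
  \prod_(i in J) (upd h k g) i = g * \prod_(i in J | i != k) h i.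
Proof.
move=> kJ; rewrite (bigD1 k)//= eqxx; congr (_ * _).
by apply: eq_bigr => i /andP[_ /negbTE->].
Qed.

Let mean_upd (h : I -> Omega -> R) k g : k \in J ->
  \prod_(i in J) mean P ((upd h k g) i) =
  mean P g * \prod_(i in J | i != k) mean P (h i).
Proof.
move=> kJ; rewrite (bigD1 k)//= eqxx; congr (_ * _).
by apply: eq_bigr => i /andP[_ /negbTE->].
Qed.

Lemma mean_prod_indic (E : I -> set Omega) : (forall i, i \in J -> <<s G i >>
  (E i)) ->
  mean P (\prod_(i in J) \1_(E i)) = \prod_(i in J) mean P (\1_(E i)).
Proof.
move=> GE; have mE i : i \in J -> measurable (E i).
  by move=> iJ; exact: (Gmeas iJ (GE i iJ)).
rewrite (_ : \prod_(i in J) _ = \1_(\bigcap_(i in [set` J]) E i)).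
  rewrite mean_indic; last first.
    by apply: fin_bigcap_measurable => // i /=; exact: mE.
  by rewrite indep//; apply: eq_bigr => i iJ; rewrite mean_indic//; exact: mE.
apply/funext => w; rewrite fct_prodE indicE.
case: (boolP (w \in _)) => [/set_mem wE|wE].
  by rewrite big1// => i iJ; rewrite indicE mem_set//; exact: wE.
have [i iJ wi] : exists2 i, i \in J & ~ E i w.
  apply: contrapT => h; move/negP : wE; apply; apply/mem_set => i /= iJ.
  by apply: contrapT => wi; apply: h; exists i.
by rewrite (bigD1 i)//= indicE memNset// mul0r.
Qed.

(** The factors are turned one at a time from indicators of events, for which
    the claim is the hypothesis of independence, into nonnegative adapted
    variables; [ks] lists the indices already treated. *)
Lemma mean_prod_ge0_adapted (ks : seq I) (h : I -> Omega -> R)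
    (E : I -> set Omega) :
  (forall i, i \in J -> <<s G i >> (E i)) ->
  (forall i, i \in J -> adapted i (h i) /\ forall w, 0 <= h i w) ->
  (forall i, i \in J -> i \notin ks -> h i = \1_(E i)) ->
  mean P (\prod_(i in J) h i) = \prod_(i in J) mean P (h i).
Proof.
elim: ks h E => [|k ks ih] h E GE hJ hE.
  rewrite (eq_bigr (fun i => \1_(E i))); last by move=> i iJ; exact: hE.
  rewrite mean_prod_indic//; apply: eq_bigr => i iJ; congr mean.
  by apply/esym/hE.
have [kJ|kJ] := boolP (k \in J); last first.
  apply: (ih h E) => // i iJ iks; apply: hE => //.
  by rewrite inE negb_or iks andbT; apply: contraNneq kJ => <-.
pose H := \prod_(i in J | i != k) h i.
pose c := \prod_(i in J | i != k) mean P (h i).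
have aH : all_moments P H.
  by apply: all_moments_prod => i /andP[iJ _]; case: (hJ i iJ) => -[].
have H0 w : 0 <= H w.
  by rewrite /H fct_prodE prodr_ge0// => i /andP[iJ _]; case: (hJ i iJ).
have c0 : 0 <= c.
  by apply: prodr_ge0 => i /andP[iJ _]; apply: mean_ge0; case: (hJ i iJ).
have [[mk ak] k0] := hJ k kJ.
have HA A : <<s G k >> A -> (\int[P]_(w in A) (H w)%:E = c%:E * P A)%E.
  move=> GA; have mA : measurable A by exact: (Gmeas kJ).
  have := ih (upd h k \1_A) (upd E k A); rewrite prod_upd// mean_upd//.
  rewrite -/H -/c mean_indic// => hA.
  have aAH : all_moments P (\1_A * H).
    by apply: all_momentsM => //; exact: all_moments_indic.
  have -> : (\int[P]_(w in A) (H w)%:E = (mean P (\1_A * H))%:E)%E.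
    rewrite -expectation_mean// unlock integral_mkcond.
    apply: eq_integral => w _; rewrite patchE/= fctE indicE.
    by case: ifP; rewrite ?mul1r ?mul0r.
  rewrite hA ?EFinM ?fineK ?fin_num_measure 1?muleC//.
  - by move=> i iJ; case: eqP => [->//|_]; exact: GE.
  - move=> i iJ; case: eqP => [->|_]; last exact: hJ.
    split; last by move=> w; rewrite indicE.
    split; last exact: all_moments_indic.
    exact: measurable_indic.
  - move=> i iJ iks; case: eqP => [//|/eqP ik]; apply: hE => //.
    by rewrite inE negb_or ik.
have hk : h = upd h k (h k) by apply/funext => i; case: eqP => // ->.
rewrite [in LHS]hk [in RHS]hk prod_upd// mean_upd// -/H -/c.
rewrite [RHS]mulrC -meanZ//; rewrite /mean /Rintegral; congr fine.
have := @integral_mul_independent (G k) (Gmeas kJ) H c (EFin \o h k)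
  (proj1 aH) H0 c0 HA.
move=> -> //; last exact/measurable_EFinP.
by apply: eq_integral => w _; rewrite -EFinM mulrC.
Qed.

(** The same induction removes the sign condition, each factor being a
    difference of two nonnegative adapted ones. *)
Lemma mean_prod_adapted (h : I -> Omega -> R) :
  (forall i, i \in J -> adapted i (h i)) ->
  mean P (\prod_(i in J) h i) = \prod_(i in J) mean P (h i).
Proof.
suff signed (ks : seq I) : (forall i, i \in J -> adapted i (h i)) ->
    (forall i, i \in J -> i \notin ks -> forall w, 0 <= h i w) ->
    mean P (\prod_(i in J) h i) = \prod_(i in J) mean P (h i).
  by move=> ah; apply: (signed (enum I)) => // i _; rewrite mem_enum.
elim: ks h => [|k ks ih] h ah h0.
  apply: (@mean_prod_ge0_adapted (enum I) h (fun=> setT)).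
  - by move=> i _; exact: (@measurableT _ (g_sigma_algebraType (G i))).
  - by move=> i iJ; split; [exact: ah|exact: h0].
  - by move=> i _; rewrite mem_enum.
have [kJ|kJ] := boolP (k \in J); last first.
  apply: ih => // i iJ iks; apply: h0 => //.
  by rewrite inE negb_or iks andbT; apply: contraNneq kJ => <-.
have [mk ak] := ah k kJ.
pose n : Omega -> R := fun w => `|h k w|.
have an : adapted k n.
  split; first exact: measurableT_comp.
  exact: all_moments_norm.
have adaptedD f g : adapted k f -> adapted k g -> adapted k (f + g).
  move=> [mf af] [mg ag]; split; last exact: all_momentsD.
  exact: measurable_funD.
have step g : adapted k g -> (forall w, 0 <= g w) ->
    mean P (g * \prod_(i in J | i != k) h i) =
    mean P g * \prod_(i in J | i != k) mean P (h i).
  move=> ag g0; rewrite -prod_upd// -mean_upd//; apply: ih.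
    by move=> i iJ; case: eqP => [->//|_]; exact: ah.
  move=> i iJ iks; case: eqP => [//|/eqP ik]; apply: h0 => //.
  by rewrite inE negb_or ik.
have hk : h = upd h k (h k) by apply/funext => i; case: eqP => // ->.
rewrite [in LHS]hk [in RHS]hk prod_upd// mean_upd//.
have -> : h k = (h k + n) - n by rewrite addrK.
have [_ aN] := an; have aH : all_moments P (\prod_(i in J | i != k) h i).
  by apply: all_moments_prod => i /andP[iJ _]; case: (ah i iJ).
have ahn : all_moments P (h k + n) by exact: all_momentsD.
rewrite mulrBl !meanB//; try exact: all_momentsM.
rewrite !step ?mulrBl//.
- by move=> w; exact: normr_ge0.
- exact: adaptedD.
- by move=> w; rewrite fctE /n -lerBlDl sub0r -normrN ler_norm.
Qed.

End Independence.

(** * The cone of products of increments *)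

Section Monomials.
Context {d : measure_display} {Omega : measurableType d} {R : realType}.
Variables (P : probability Omega R) (T : R) (r : nat).
Variable B : r.-tuple (R -> Omega -> R).
Hypothesis hB : forall j : 'I_r,
  (exists H : R, 2^-1 < H /\ is_fBm P T H (tnth B j)) \/
  same_process T (tnth B j) (fun u _ => u).
Hypothesis hindep : equal_or_independent P T B.

Local Notation E := (mean P).
Local Notation dB j := (increment (tnth B j)).

Lemma identity_increment j (i : subinterval T) :
  same_process T (tnth B j) (fun u _ => u) ->
  dB j i = cst (upper i - lower i).
Proof.
move=> Bj; rewrite /increment !Bj ?upper_itv ?lower_itv//.
Qed.

Lemma identity_prod j (s : seq (subinterval T)) :
  same_process T (tnth B j) (fun u _ => u) ->
  exists2 c : R, 0 <= c & \prod_(i <- s) dB j i = cst c.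
Proof.
move=> Bj; elim: s => [|i s [c c0 sE]]; first by exists 1; rewrite ?big_nil.
exists ((upper i - lower i) * c).
  by rewrite mulr_ge0// subr_ge0; case/and3P: (subinterval_order i).
by rewrite big_cons sE identity_increment.
Qed.

Lemma increment_all_moments j (i : subinterval T) : all_moments P (dB j i).
Proof.
case: (hB j) => [[H [_ fB]]|Bj]; first exact: (fBm_increment_all_moments fB).
by rewrite identity_increment//; exact: all_moments_cst.
Qed.

Lemma increment_prod_ge0 j (s : seq (subinterval T)) :
  0 <= E (\prod_(i <- s) dB j i).
Proof.
case: (hB j) => [[H [H2 fB]]|Bj]; first exact: (fBm_prod_ge0 fB).
by have [c c0 ->] := identity_prod s Bj; rewrite mean_cst.
Qed.

Lemma increment_prod_cov_ge0 j (s t : seq (subinterval T)) :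
  E (\prod_(i <- s) dB j i) * E (\prod_(i <- t) dB j i) <=
  E (\prod_(i <- s) dB j i * \prod_(i <- t) dB j i).
Proof.
case: (hB j) => [[H [H2 fB]]|Bj]; first exact: (fBm_prod_cov_ge0 fB).
have [c c0 ->] := identity_prod s Bj; have [c' c0' ->] := identity_prod t Bj.
by rewrite (_ : cst c * cst c' = cst (c * c'))// !mean_cst.
Qed.

Local Notation G j :=
  (\bigcup_(u in `[0, T]) preimage_set_system setT (tnth B j u) measurable).

Lemma measurable_process j u : u \in `[0, T] -> measurable_fun setT (tnth B j
  u).
Proof.
move=> uT; case: (hB j) => [[H [_ fB]]|->//].
exact: (proj1 (linear_span_gaussian_rv fB (linear_span_mem _ uT))).
Qed.

Lemma process_sigma_measurable j : <<s G j >> `<=` measurable.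
Proof.
apply: smallest_sub; first exact: sigma_algebra_measurable.
by move=> _ [u uT [A mA <-]]; exact: measurable_process.
Qed.

Lemma increment_adapted j (i : subinterval T) :
  measurable_fun setT (dB j i : g_sigma_algebraType (G j) -> R).
Proof.
have mu u : u \in `[0, T] ->
    measurable_fun setT (tnth B j u : g_sigma_algebraType (G j) -> R).
  by move=> uT _ A mA; apply: sub_sigma_algebra; exists u => //; exists A.
by apply: measurable_funB; apply: mu; [exact: upper_itv|exact: lower_itv].
Qed.

(** One index chosen in each class of indices carrying the same process. *)
Definition representative (j : 'I_r) : 'I_r :=
  odflt j [pick i | `[< same_process T (tnth B i) (tnth B j) >]].

Lemma representative_same j :
  same_process T (tnth B (representative j)) (tnth B j).
Proof.
rewrite /representative; case: pickP => [i /asboolP//|/(_ j)].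
by move/negP => []; apply/asboolP.
Qed.

Lemma representative_eq i j : same_process T (tnth B i) (tnth B j) ->
  representative i = representative j.
Proof.
move=> ij; rewrite /representative; have same k :
    `[< same_process T (tnth B k) (tnth B i) >] =
    `[< same_process T (tnth B k) (tnth B j) >].
  apply/asboolP/asboolP => h u uT; first by rewrite h// ij.
  by rewrite h// ij.
rewrite (eq_pick same); case: pickP => // /(_ j) /negP[].
exact/asboolP.
Qed.

Let J : {set 'I_r} := [set representative j | j : 'I_r].

Let indepJ : mutually_independent P J (fun j => <<s G j >>).
Proof.
apply: hindep => _ _ /imsetP[i _ ->] /imsetP[j _ ->] /eqP ij same; apply: ij.
apply: representative_eq => u uT.
by rewrite -representative_same// same// representative_same.
Qed.

Definition monomial (s : seq ('I_r * subinterval T)) : Omega -> R :=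
  \prod_(x <- s) dB x.1 x.2.

Lemma monomial_all_moments s : all_moments P (monomial s).
Proof. by apply: all_moments_prod => x _; exact: increment_all_moments. Qed.

Lemma monomial_cat s t : monomial (s ++ t) = monomial s * monomial t.
Proof. by rewrite /monomial big_cat. Qed.

Let group (s : seq ('I_r * subinterval T)) k :=
  [seq x.2 | x <- s & representative x.1 == k].

Let groupprod s k := \prod_(i <- group s k) dB k i.

(** Increments of equal processes are collected in one group, so that the
    groups are independent. *)
Lemma monomial_group s : monomial s = \prod_(k in J) groupprod s k.
Proof.
rewrite /monomial (partition_big (fun x => representative x.1) (mem J))/=;
  last first.
  by move=> x _; exact: imset_f.
apply: eq_bigr => k _; rewrite /groupprod /group big_map big_filter.
apply: eq_bigr => x /eqP <-; rewrite /increment.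
by rewrite !representative_same ?upper_itv ?lower_itv.
Qed.

Let groupprod_adapted s k : adapted P (fun j => G j) k (groupprod s k).
Proof.
split; last by apply: all_moments_prod => i _; exact: increment_all_moments.
rewrite /groupprod; elim/big_rec : _ => [|i x _ mx];
  first exact: measurable_cst.
by apply: measurable_funM => //; exact: increment_adapted.
Qed.

Lemma mean_monomial s : E (monomial s) = \prod_(k in J) E (groupprod s k).
Proof.
rewrite monomial_group; apply: (mean_prod_adapted _ indepJ) => //.
by move=> k _; exact: process_sigma_measurable.
Qed.

Lemma mean_monomial_ge0 s : 0 <= E (monomial s).
Proof. by rewrite mean_monomial prodr_ge0// => k _;
  exact: increment_prod_ge0. Qed.

(** The inequality holds in each group, and inequalities between nonnegative
    numbers multiply. *)
Lemma monomial_cov_ge0 s t :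
  E (monomial s) * E (monomial t) <= E (monomial s * monomial t).
Proof.
rewrite -monomial_cat !mean_monomial -big_split/=; apply: ler_prod => k _.
rewrite mulr_ge0 ?increment_prod_ge0//=.
by rewrite /groupprod /group filter_cat map_cat big_cat/=
  increment_prod_cov_ge0.
Qed.

Definition monomial_sum (l : seq (R * seq ('I_r * subinterval T))) : Omega -> R
  :=
  \sum_(x <- l) x.1 *: monomial x.2.

Definition monomial_cone : set (Omega -> R) :=
  [set X | exists2 l, all (fun x => 0 <= x.1) l & X = monomial_sum l].

Lemma monomial_cone_all_moments X : monomial_cone X -> all_moments P X.
Proof.
move=> [l _ ->]; apply: all_moments_sum => x _.
exact/all_momentsZ/monomial_all_moments.
Qed.

Lemma monomial_cone_cst (c : R) : 0 <= c -> monomial_cone (cst c).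
Proof.
move=> c0; exists [:: (c, [::])]; first by rewrite /= c0.
rewrite /monomial_sum /monomial big_seq1 big_nil; apply/funext => w.
by rewrite !fctE/= /GRing.scale/= mulr1.
Qed.

Lemma monomial_coneD X Y :
  monomial_cone X -> monomial_cone Y -> monomial_cone (X + Y).
Proof.
move=> [l l0 ->] [l' l0' ->]; exists (l ++ l'); first by rewrite all_cat l0.
by rewrite /monomial_sum big_cat.
Qed.

Lemma monomial_coneM X Y :
  monomial_cone X -> monomial_cone Y -> monomial_cone (X * Y).
Proof.
move=> [l l0 ->] [l' l0' ->].
exists [seq (x.1 * y.1, x.2 ++ y.2) | x <- l, y <- l'].
  apply/allP => _ /allpairsP[[x y] /= [xl yl ->]] /=.
  by rewrite mulr_ge0//; [exact: (allP l0)|exact: (allP l0')].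
rewrite /monomial_sum big_allpairs_dep big_distrl; apply: eq_bigr => x _.
rewrite big_distrr; apply: eq_bigr => y _; rewrite /= monomial_cat.
by apply/funext => w; rewrite !fctE /GRing.scale/=; ring.
Qed.

Lemma monomial_cone_increment j (i : subinterval T) : monomial_cone (dB j i).
Proof.
exists [:: (1, [:: (j, i)])]; first by rewrite /= ler01.
by rewrite /monomial_sum /monomial !big_seq1 scale1r.
Qed.

Lemma mean_monomial_sum l : E (monomial_sum l) = \sum_(x <- l) x.1 * E
  (monomial x.2).
Proof.
rewrite mean_sum; last by move=> x _; exact/all_momentsZ/monomial_all_moments.
by apply: eq_bigr => x _; rewrite meanZ//; exact: monomial_all_moments.
Qed.

Lemma monomial_cone_mean_ge0 X : monomial_cone X -> 0 <= E X.
Proof.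
move=> [l l0 ->]; rewrite mean_monomial_sum big_seq sumr_ge0// => x xl.
by rewrite mulr_ge0 ?mean_monomial_ge0//; exact: (allP l0).
Qed.

Lemma monomial_cone_cov_ge0 X Y :
  monomial_cone X -> monomial_cone Y -> E X * E Y <= E (X * Y).
Proof.
move=> [l l0 ->] [l' l0' ->].
have -> : monomial_sum l * monomial_sum l' =
    \sum_(x <- l) \sum_(y <- l') (x.1 * y.1) *: (monomial x.2 * monomial y.2).
  rewrite big_distrl; apply: eq_bigr => x _.
  rewrite big_distrr; apply: eq_bigr => y _; rewrite /=.
  by apply/funext => w; rewrite !fctE /GRing.scale/=; ring.
have am x y : all_moments P (monomial x * monomial y).
  by apply: all_momentsM; exact: monomial_all_moments.
rewrite !mean_monomial_sum mean_sum; last first.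
  by move=> x _; apply: all_moments_sum => y _; exact: all_momentsZ.
rewrite big_distrl/= big_seq [leRHS]big_seq.
apply: ler_sum => x xl; rewrite mean_sum; last by move=> y _;
  exact: all_momentsZ.
rewrite big_distrr/= big_seq [leRHS]big_seq; apply: ler_sum => y yl.
rewrite meanZ// mulrACA ler_wpM2l ?monomial_cov_ge0// mulr_ge0//.
  exact: (allP l0).
exact: (allP l0').
Qed.

End Monomials.

(** * Closure of a cone in all moments *)

Section EvenMoments.
Context {d : measure_display} {Omega : measurableType d} {R : realType}.
Variable P : probability Omega R.
Local Notation E := (mean P).
Implicit Types X Y Z V W : Omega -> R.

Lemma even_exp_ge0 k (x : R) : 0 <= x ^+ k.*2.+2.
Proof. by rewrite exprn_even_ge0//= odd_double. Qed.

Lemma even_exp_norm k (x : R) : `|x| ^+ k.*2.+2 = x ^+ k.*2.+2.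
Proof. by rewrite -normrX ger0_norm// even_exp_ge0. Qed.

Lemma pow2_split n (e : R) : 0 < e -> exists2 c : R, 0 < c & 2 ^+ n * (c + c) =
  e.
Proof.
move=> e0; exists (e / (2 ^+ n * 2));
  first by rewrite divr_gt0// mulr_gt0// exprn_gt0.
by field; rewrite expf_neq0.
Qed.

Lemma mean_even_expD k X Y : all_moments P X -> all_moments P Y ->
  E ((X + Y) ^+ k.*2.+2) <=
  2 ^+ k.*2.+2 * (E (X ^+ k.*2.+2) + E (Y ^+ k.*2.+2)).
Proof.
move=> aX aY; have [aXk aYk] := (all_momentsX k.*2.+2 aX, all_momentsX k.*2.+2
  aY).
rewrite -meanD// -meanZ; last exact: all_momentsD.
apply: mean_le; first exact/all_momentsX/all_momentsD.
  by apply: all_momentsZ; exact: all_momentsD.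
move=> w; have := @exp_normD_le _ (X w) (Y w) k.*2.+2.
by rewrite !even_exp_norm !fctE.
Qed.

Lemma mean_even_expN k X : E ((- X) ^+ k.*2.+2) = E (X ^+ k.*2.+2).
Proof.
congr mean; apply/funext => w; rewrite !fctE -even_exp_norm normrN.
by rewrite even_exp_norm.
Qed.

(** Weighted inequality of the means, |u v| <= (l v^2 + u^2 / l) / 2. *)
Lemma mean_mul_small V (e : R) : all_moments P V -> 0 < e ->
  exists2 dl : R, 0 < dl &
    forall W, all_moments P W -> E (W ^+ 2) <= dl -> `|E (W * V)| <= e.
Proof.
move=> aV e0; have aV2 := all_momentsX 2 aV.
have V0 : 0 <= E (V ^+ 2) by apply: mean_ge0 => w; rewrite fctE sqr_ge0.
(* Adding 1 keeps the denominator positive. *)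
pose l := e / (E (V ^+ 2) + 1).
have l0 : 0 < l by rewrite divr_gt0// ltr_wpDl.
exists (e * l); first exact: mulr_gt0.
move=> W aW hW; have aW2 := all_momentsX 2 aW.
have bnd Z : all_moments P Z -> (forall w, `|Z w| <= `|W w * V w|) -> E Z <= e.
  move=> aZ ZW; rewrite (@le_trans _ _ (E ((l / 2) *: V ^+ 2 + (l^-1 / 2) *: W
    ^+ 2)))//.
    apply: mean_le => //; first by apply: all_momentsD; exact: all_momentsZ.
    move=> w; rewrite (le_trans (ler_norm _))// (le_trans (ZW w))// normrM.
    rewrite !fctE /GRing.scale/= -[V w ^+ 2]real_normK ?num_real//.
    rewrite -[W w ^+ 2]real_normK ?num_real//.
    set v := `|V w|; set u := `|W w|.
    have : 0 <= l^-1 * (l * v - u) ^+ 2 by rewrite mulr_ge0 ?invr_ge0 ?sqr_ge0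
      ?ltW.
    have -> : l^-1 * (l * v - u) ^+ 2 = l * v ^+ 2 - 2 * (u * v) + l^-1 * u ^+
      2.
      by field; rewrite gt_eqF.
    lra.
  rewrite meanD ?meanZ//; try exact: all_momentsZ.
  have h1 : l * E (V ^+ 2) <= e.
    rewrite /l mulrAC ler_pdivrMr ?ltr_wpDl// ler_wpM2l ?lerDl//; exact: ltW.
  have h2 : l^-1 * E (W ^+ 2) <= e.
    by rewrite mulrC ler_pdivrMr.
  lra.
have aWV : all_moments P (W * V) by exact: all_momentsM.
rewrite ler_norml lerNl -meanN// !bnd//; first exact: all_momentsN.
by move=> w; rewrite fctE normrN.
Qed.

Lemma even_exp_mul_small k X (e : R) : all_moments P X -> 0 < e ->
  exists2 dl : R, 0 < dl & forall W, all_moments P W ->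
    E (W ^+ k.*2.+1.*2.+2) <= dl -> E ((W * X) ^+ k.*2.+2) <= e.
Proof.
move=> aX e0; have [dl dl0 hdl] := mean_mul_small (all_momentsX k.*2.+2 aX) e0.
exists dl => // W aW hW; rewrite exprMn (le_trans (ler_norm _))//; apply: hdl.
  exact: all_momentsX.
by rewrite -exprM (_ : (k.*2.+2 * 2 = k.*2.+1.*2.+2)%N)//; lia.
Qed.

End EvenMoments.

Section Closure.
Context {d : measure_display} {Omega : measurableType d} {R : realType}.
Variable P : probability Omega R.
Local Notation E := (mean P).
Variable D : set (Omega -> R).
Hypotheses (D_moments : forall X, D X -> all_moments P X)
  (D_add : forall X Y, D X -> D Y -> D (X + Y))
  (D_mul : forall X Y, D X -> D Y -> D (X * Y))
  (D_mean : forall X, D X -> 0 <= E X)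
  (D_cov : forall X Y, D X -> D Y -> E X * E Y <= E (X * Y)).

(** Even exponents avoid absolute values; the exponent zero is excluded since
    its moment is always one. *)
Definition moment_approx (S : set (Omega -> R)) (X : Omega -> R) : Prop :=
  forall (k : nat) (e : R), 0 < e ->
    exists2 Y, S Y & E ((X - Y) ^+ k.*2.+2) <= e.

Definition moment_closure : set (Omega -> R) :=
  [set X | all_moments P X /\ moment_approx D X].

Lemma moment_closure_sub X : D X -> moment_closure X.
Proof.
move=> DX; split; first exact: D_moments.
move=> k e e0; exists X => //; rewrite subrr expr0n/= [E 0]mean_cst.
exact: ltW.
Qed.

Lemma moment_closure_closed X : all_moments P X ->
  moment_approx moment_closure X -> moment_closure X.
Proof.
move=> aX hX; split=> // k e e0.
have [c c0 ce] := pow2_split k.*2.+2 e0.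
have [Y [aY hY] XY] := hX k _ c0; have [Z DZ YZ] := hY k _ c0.
have aZ := D_moments DZ; exists Z => //.
have -> : X - Z = (X - Y) + (Y - Z) by rewrite addrA subrK.
rewrite (le_trans (mean_even_expD k _ _))//; try exact: all_momentsB.
rewrite -ce; apply: ler_wpM2l; first by rewrite exprn_ge0.
exact: (lerD XY YZ).
Qed.

Lemma moment_closureD X Y :
  moment_closure X -> moment_closure Y -> moment_closure (X + Y).
Proof.
move=> [aX hX] [aY hY]; split; first exact: all_momentsD.
move=> k e e0.
have [c c0 ce] := pow2_split k.*2.+2 e0.
have [X' DX' XX'] := hX k _ c0; have [Y' DY' YY'] := hY k _ c0.
have [aX' aY'] := (D_moments DX', D_moments DY').
exists (X' + Y'); first exact: D_add.
have -> : X + Y - (X' + Y') = (X - X') + (Y - Y') by rewrite opprD addrACA.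
rewrite (le_trans (mean_even_expD k _ _))//; try exact: all_momentsB.
rewrite -ce; apply: ler_wpM2l; first by rewrite exprn_ge0.
exact: (lerD XX' YY').
Qed.

(** One factor is approximated at a time, the other one being kept fixed, in
    order to use [even_exp_mul_small]. *)
Lemma moment_closureM X Y :
  moment_closure X -> moment_closure Y -> moment_closure (X * Y).
Proof.
move=> cX cY; have [[aX hX] [aY hY]] := (cX, cY).
apply: moment_closure_closed; first exact: all_momentsM.
move=> k e e0; have [dl dl0 hdl] := even_exp_mul_small k aX e0.
have [Y' DY' YY'] := hY k.*2.+1 _ dl0; have aY' := D_moments DY'.
exists (X * Y'); last first.
  by rewrite -mulrBr mulrC; apply: hdl => //; exact: all_momentsB.
split; first exact: all_momentsM.
move=> j c c0; have [dl' dl0' hdl'] := even_exp_mul_small j aY' c0.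
have [X' DX' XX'] := hX j.*2.+1 _ dl0'; have aX' := D_moments DX'.
exists (X' * Y'); first exact: D_mul.
by rewrite -mulrBl; apply: hdl' => //; exact: all_momentsB.
Qed.

(** For fixed [V], the covariance with [V] is continuous for the second
    moment. *)
Lemma moment_closure_cov_closed X V : all_moments P X -> all_moments P V ->
  moment_approx [set Y | all_moments P Y /\ E Y * E V <= E (Y * V)] X ->
  E X * E V <= E (X * V).
Proof.
move=> aX aV hX; apply/ler_addgt0Pr => e e0.
have aVc : all_moments P (V - cst (E V)).
  by apply: all_momentsB => //; exact: all_moments_cst.
have [dl dl0 hdl] := mean_mul_small aVc e0.
have [Y [aY YV] XY] := hX 0%N _ dl0.
have := hdl _ (all_momentsB aX aY) XY.
have -> : (X - Y) * (V - cst (E V)) = (X * V - Y * V) - E V *: (X - Y).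
  by apply/funext => w; rewrite !fctE /GRing.scale/=; ring.
have [aXV aYV] := (all_momentsM aX aV, all_momentsM aY aV).
rewrite !meanB ?meanZ ?meanB//; try exact: all_momentsB.
- rewrite ler_norml => /andP[h _].
  move: YV h; lra.
- by apply: all_momentsZ; exact: all_momentsB.
Qed.

Lemma moment_closure_cov_ge0 X Y : moment_closure X -> moment_closure Y ->
  E X * E Y <= E (X * Y).
Proof.
move=> [aX hX] [aY hY]; apply: moment_closure_cov_closed;
  [exact: aX|exact: aY|].
move=> k e e0; have [X' DX' XX'] := hX k e e0; exists X' => //.
have aX' := D_moments DX'; split=> //; rewrite mulrC [X' * Y]mulrC.
apply: moment_closure_cov_closed; [exact: aY|exact: aX'|].
move=> k' e' e0'.
have [Y' DY' YY'] := hY k' e' e0'; exists Y' => //.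
by split; [exact: D_moments|exact: D_cov].
Qed.

Lemma moment_closure_mean_ge0 X : moment_closure X -> 0 <= E X.
Proof.
move=> [aX hX]; apply/ler_addgt0Pr => e e0.
have [dl dl0 hdl] := mean_mul_small (all_moments1 P) e0.
have [Y DY XY] := hX 0%N _ dl0; have aY := D_moments DY.
have := hdl _ (all_momentsB aX aY) XY.
rewrite mulr1 meanB// ler_norml => /andP[h _].
have := D_mean DY; lra.
Qed.

End Closure.

(** * Limits of dominated sequences in a closed cone *)

Section LimitsInPositiveCone.
Context {d : measure_display} {Omega : measurableType d} {R : realType}.
Variable P : probability Omega R.
Local Notation E := (mean P).
Implicit Types X Y M G : Omega -> R.

(** Monotone convergence in the level of truncation. *)
Lemma all_moments_of_bound G (C : nat -> R) : measurable_fun setT G ->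
  (forall k (n : nat),
     (\int[P]_w (Num.min `|G w| n%:R ^+ k)%:E <= (C k)%:E)%E) ->
  all_moments P G.
Proof.
move=> mG bC; split=> // k; apply/integrableP; split.
  by apply/measurable_EFinP; exact: measurable_exp.
pose g n w : \bar R := (Num.min `|G w| n%:R ^+ k)%:E.
have mg n : measurable_fun setT (g n).
  apply/measurable_EFinP; apply: measurable_funX.
  by apply: measurable_minr => //; exact: measurableT_comp.
have g0 n w : (0 <= g n w)%E by rewrite lee_fin exprn_ge0// le_min normr_ge0/=.
have ndg w : {homo g ^~ w : n m / (n <= m)%N >-> (n <= m)%E}.
  move=> n m nm; rewrite lee_fin lerXn2r ?nnegrE ?le_min ?normr_ge0//=.
  by rewrite !ge_min lexx/= ler_nat nm orbT.
have limg w : (g n w @[n --> \oo] --> (`|G w| ^+ k)%:E)%E.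
  apply: cvg_near_cst; near=> n; rewrite /g (min_idPl _)//.
  by near: n; exact: nbhs_infty_ger.
rewrite (eq_integral (fun w => limn (g ^~ w))); last first.
  move=> w _; rewrite (cvg_lim _ (limg w))//.
  by rewrite /= exprfctE normrX.
rewrite (monotone_convergence P measurableT mg (fun n w _ => g0 n w)
  (fun w _ => ndg w)).
rewrite (@le_lt_trans _ _ (C k)%:E) ?ltry//; apply: lime_le.
  apply: ereal_nondecreasing_is_cvgn => n m nm; apply: ge0_le_integral => //.
  by move=> w _; exact: ndg.
by apply: nearW => n; exact: bC.
Unshelve. all: by end_near.
Qed.

Lemma exp_min_le (x y K : R) k : 0 <= K ->
  Num.min `|x| K ^+ k.+1 <=
  2 ^+ k.+1 * (`|y| ^+ k.+1 + K ^+ k * `|x - y|).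
Proof.
move=> K0; pose m := Num.min `|x - y| K.
have m0 : 0 <= m by rewrite le_min normr_ge0.
have ym0 : 0 <= `|y| + m by rewrite addr_ge0.
apply: (@le_trans _ _ ((`|y| + m) ^+ k.+1)).
  rewrite lerXn2r ?nnegrE ?le_min ?normr_ge0//.
  have := ler_normD (x - y) y; rewrite subrK => xy; have y0 := normr_ge0 y.
  by rewrite /m ge_min; case: (leP `|x - y| K) => h; apply/orP; [left|right];
    lra.
have := exp_normD_le `|y| m k.+1;
  rewrite (ger0_norm ym0) (ger0_norm m0) normr_id.
move=> /le_trans; apply; rewrite ler_wpM2l ?exprn_ge0// lerD2l exprS mulrC.
by apply: ler_pM; rewrite ?exprn_ge0 ?lerXn2r ?nnegrE// ge_min lexx ?orbT.
Qed.

(** For |x| <= K the first term dominates, for |x| >= K the second one; this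
    trades L^1 smallness and a higher bounded moment for smallness of a
    moment. *)
Lemma even_exp_interpolation (x K : R) k : 0 < K ->
  x ^+ k.*2.+2 <= K ^+ k.*2.+1 * `|x| + K ^- 2 * x ^+ k.+1.*2.+2.
Proof.
move=> K0; rewrite -(even_exp_norm k x) -(even_exp_norm k.+1 x); set y := `|x|.
have y0 : 0 <= y := normr_ge0 x.
have [yK|/ltW Ky] := leP y K.
  rewrite (@le_trans _ _ (K ^+ k.*2.+1 * y))//.
    by rewrite exprSr ler_wpM2r// lerXn2r ?nnegrE// ltW.
  by rewrite lerDl mulr_ge0 ?invr_ge0 ?exprn_ge0// ltW.
rewrite (@le_trans _ _ (K ^- 2 * y ^+ k.+1.*2.+2))//.
  rewrite doubleS -[k.*2.+4]/(2 + k.*2.+2)%N exprD mulrA ler_peMl ?exprn_ge0//.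
  by rewrite mulrC ler_pdivlMr ?exprn_gt0// mul1r lerXn2r ?nnegrE// ltW.
by rewrite lerDr mulr_ge0 ?exprn_ge0// ltW.
Qed.

(** [C] stands for a closed cone of random variables that is also stable under
    products; it induces the order in which the limits below are dominated. *)
Variable C : set (Omega -> R).
Hypotheses (C_moments : forall X, C X -> all_moments P X)
  (C_cst : forall c : R, 0 <= c -> C (cst c))
  (C_add : forall X Y, C X -> C Y -> C (X + Y))
  (C_mul : forall X Y, C X -> C Y -> C (X * Y))
  (C_mean : forall X, C X -> 0 <= E X)
  (C_closed : forall X, all_moments P X -> moment_approx P C X -> C X).

Lemma cone_sum (I : Type) (s : seq I) (Q : pred I) (F : I -> Omega -> R) :
  (forall i, Q i -> C (F i)) -> C (\sum_(i <- s | Q i) F i).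
Proof.
move=> CF; elim/big_ind : _ => //; exact: (C_cst (lexx 0)).
Qed.

Lemma cone_exp X n : C X -> C (X ^+ n).
Proof.
move=> CX; elim: n => [|n ih]; first exact: (C_cst ler01).
by rewrite exprS; exact: C_mul.
Qed.

(** The difference of the powers is [M - X] times a polynomial in [M] and [X]
    with nonnegative coefficients. *)
Lemma cone_mean_exp_le X M n : C X -> C (M - X) -> E (X ^+ n) <= E (M ^+ n).
Proof.
move=> CX CMX; have CM : C M by rewrite -(subrK X M); exact: C_add.
rewrite -subr_ge0 -meanB; [|exact/C_moments/cone_exp..].
apply: C_mean; rewrite subrXX; apply: C_mul => //.
by apply: cone_sum => i _; apply: C_mul; exact: cone_exp.
Qed.

Lemma cone_mean_exp_sub_le G X M k : all_moments P G -> C X -> C (M - X) ->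
  E ((G - X) ^+ k.*2.+2) <=
  2 ^+ k.*2.+2 * (E (G ^+ k.*2.+2) + E (M ^+ k.*2.+2)).
Proof.
move=> aG CX CMX; have aX := all_momentsN (C_moments CX).
apply: le_trans (mean_even_expD k aG aX) _.
apply: ler_wpM2l; first by rewrite exprn_ge0.
by rewrite mean_even_expN lerD2l; exact: cone_mean_exp_le.
Qed.

(** L^1 convergence gives no moments by itself, but truncated powers of [G]
    are controlled by the moments of [X n], hence by those of [M], and by the
    L^1 distance, in a way that does not depend on the truncation. *)
Lemma cone_limit_all_moments (X : nat -> Omega -> R) M G :
  (forall n, C (X n)) -> (forall n, C (M - X n)) ->
  P.-integrable setT (EFin \o G) ->
  (forall e : R, 0 < e -> exists n, \int[P]_w `|G w - X n w| <= e) ->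
  all_moments P G.
Proof.
move=> CX CMX iG lG.
have mG : measurable_fun setT G.
  by apply/measurable_EFinP; exact: measurable_int iG.
have even_bound k (K : nat) : (0 < k)%N -> ~~ odd k ->
    (\int[P]_w (Num.min `|G w| K%:R ^+ k)%:E <=
     (2 ^+ k * (E (M ^+ k) + 1))%:E)%E.
  case: k => // k _ ek.
  have K0 : 0 <= K%:R :> R by exact: ler0n.
  have [n hn] : exists n, K%:R ^+ k * \int[P]_w `|G w - X n w| <= 1.
    have [|n hn] := lG ((K%:R ^+ k + 1)^-1).
      by rewrite invr_gt0 ltr_wpDl ?exprn_ge0.
    exists n; rewrite (le_trans (ler_wpM2l _ hn)) ?exprn_ge0//.
    by rewrite ler_pdivrMr ?mul1r ?lerDl// ltr_wpDl ?exprn_ge0.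
  have aX := C_moments (CX n).
  have iX : P.-integrable setT (EFin \o (fun w => `|X n w| ^+ k.+1)).
    have := all_moments_integrable (all_momentsX k.+1 (all_moments_norm aX)).
    by rewrite exprfctE.
  have iGX : P.-integrable setT (EFin \o (fun w => `|G w - X n w|)).
    apply: (integrable_norm (f := fun w => G w - X n w)).
    exact: (integrableB measurableT iG (all_moments_integrable aX)).
  have iKGX : P.-integrable setT (EFin \o (fun w =>
    K%:R ^+ k * `|G w - X n w|)).
    exact: (integrableZl measurableT (K%:R ^+ k) iGX).
  have iS : P.-integrable setT
      (EFin \o (fun w => `|X n w| ^+ k.+1 + K%:R ^+ k * `|G w - X n w|)).
    exact: (integrableD measurableT iX iKGX).
  have iR : P.-integrable setT (EFin \o (fun w =>
      2 ^+ k.+1 * (`|X n w| ^+ k.+1 + K%:R ^+ k * `|G w - X n w|))).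
    exact: (integrableZl measurableT (2 ^+ k.+1) iS).
  have mm : measurable_fun setT (fun w => Num.min `|G w| K%:R ^+ k.+1).
    apply: measurable_funX; apply: measurable_minr => //.
    exact: measurableT_comp.
  have iL : P.-integrable setT (EFin \o (fun w => Num.min `|G w| K%:R ^+ k.+1)).
    apply: integrable_dominated iR => // w.
    by rewrite ger0_norm ?exp_min_le// exprn_ge0// le_min normr_ge0.
  have -> : (\int[P]_w (Num.min `|G w| K%:R ^+ k.+1)%:E)%E =
      (\int[P]_w (Num.min `|G w| K%:R ^+ k.+1))%:E.
    by rewrite /Rintegral fineK//; exact: integrable_fin_num.
  rewrite lee_fin (@le_trans _ _ (\int[P]_w (2 ^+ k.+1 *
      (`|X n w| ^+ k.+1 + K%:R ^+ k * `|G w - X n w|))))//.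
    by apply: le_Rintegral => // w _; exact: exp_min_le.
  rewrite RintegralZl// ler_wpM2l ?exprn_ge0// RintegralD// RintegralZl//.
  rewrite lerD//; apply: le_trans (cone_mean_exp_le k.+1 (CX n) (CMX n)).
  rewrite le_eqVlt; apply/orP; left; apply/eqP; congr fine.
  apply: eq_integral => w _; rewrite !exprfctE -normrX ger0_norm//.
  by rewrite exprn_even_ge0.
apply: (@all_moments_of_bound G
  (fun k => 1 + 2 ^+ k.*2.+2 * (E (M ^+ k.*2.+2) + 1))) => // k K.
have min0 w : 0 <= Num.min `|G w| K%:R :> R by rewrite le_min normr_ge0/=.
have mm : measurable_fun setT (fun w => Num.min `|G w| K%:R).
  by apply: measurable_minr => //; exact: measurableT_comp.
apply: (@le_trans _ _ (\int[P]_w (1 + (Num.min `|G w| K%:R ^+ k.*2.+2)%:E))%E).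
  apply: ge0_le_integral => //.
  - by apply/measurable_EFinP; exact: measurable_funX.
  - apply: emeasurable_funD => //.
    by apply/measurable_EFinP; exact: measurable_funX.
  - move=> w _; rewrite -EFinD lee_fin.
    have [m1|/ltW m1] := leP (Num.min `|G w| K%:R) 1.
      by rewrite (@le_trans _ _ 1) ?exprn_ile1// lerDl exprn_ge0.
    rewrite (@le_trans _ _ (Num.min `|G w| K%:R ^+ k.*2.+2))//.
      by rewrite ler_weXn2l//; lia.
    by rewrite lerDr.
rewrite ge0_integralD//; last first.
  by apply/measurable_EFinP; exact: measurable_funX.
rewrite integral_cst// [X in (1 * X)%E]probability_setT mule1 EFinD leeD2l//.
by apply: even_bound => //=; rewrite odd_double.
Qed.

(** A sequence between 0 and [M] in the order of the cone has bounded moments,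
    so its L^1 limits are limits in all moments. *)
Lemma cone_limit (X : nat -> Omega -> R) M G :
  (forall n, C (X n)) -> (forall n, C (M - X n)) ->
  P.-integrable setT (EFin \o G) ->
  (forall e : R, 0 < e -> exists n, \int[P]_w `|G w - X n w| <= e) ->
  C G.
Proof.
move=> CX CMX iG lG; have aG := cone_limit_all_moments CX CMX iG lG.
apply: C_closed => // k e e0.
pose A := 2 ^+ k.+1.*2.+2 * (E (G ^+ k.+1.*2.+2) + E (M ^+ k.+1.*2.+2)).
have bA n : E ((G - X n) ^+ k.+1.*2.+2) <= A by exact: cone_mean_exp_sub_le.
have A0 : 0 <= A.
  by apply: le_trans (bA 0%N); apply: mean_ge0 => w;
    rewrite exprfctE even_exp_ge0.
(* The truncation level makes A / K^2 at most e / 2. *)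
pose K := 1 + 2 * A / e.
have K1 : 1 <= K.
  by rewrite lerDl divr_ge0 ?(ltW e0)// mulr_ge0.
have K0 : 0 < K by exact: lt_le_trans K1.
have [|n hn] := lG (e / (2 * K ^+ k.*2.+1)).
  by rewrite divr_gt0// mulr_gt0// exprn_gt0.
exists (X n) => //; have aX := C_moments (CX n).
have aGX : all_moments P (G - X n) by exact: all_momentsB.
have aN := all_moments_norm aGX.
rewrite (@le_trans _ _ (E (K ^+ k.*2.+1 *: (fun w => `|(G - X n) w|) +
    K ^- 2 *: (G - X n) ^+ k.+1.*2.+2)))//.
  apply: mean_le; first exact: all_momentsX.
    by apply: all_momentsD; apply: all_momentsZ => //; exact: all_momentsX.
  by move=> w; have := even_exp_interpolation ((G - X n) w) k K0; rewrite !fctE.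
rewrite meanD; [|exact: all_momentsZ|by apply: all_momentsZ;
  exact: all_momentsX].
rewrite !meanZ//; last exact: all_momentsX.
have h1 : K ^+ k.*2.+1 * E (fun w => `|(G - X n) w|) <= e / 2.
  rewrite -ler_pdivlMl ?exprn_gt0// (le_trans hn)// invfM mulrA mulrC.
  exact: lexx.
have h2 : K ^- 2 * E ((G - X n) ^+ k.+1.*2.+2) <= e / 2.
  rewrite mulrC ler_pdivrMr ?exprn_gt0// (le_trans (bA n))//.
  have KA : A <= e / 2 * K.
    have -> : e / 2 * K = A + e / 2 by rewrite /K; field; rewrite gt_eqF.
    by rewrite lerDl divr_ge0// ltW.
  apply: le_trans KA _; apply: ler_wpM2l; first by rewrite divr_ge0// ltW.
  by rewrite expr2 ler_peMl// ltW.
by rewrite [leRHS]splitr lerD.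
Qed.

End LimitsInPositiveCone.

(** * From L^p convergence to L^1 convergence *)

Section LpToL1.
Context {d : measure_display} {Omega : measurableType d} {R : realType}.
Variable P : probability Omega R.

Lemma Lfun_integrable_ge1 (p : R) (f : Omega -> R) : 1 <= p ->
  f \in Lfun P p%:E -> P.-integrable setT (EFin \o f).
Proof.
move=> p1 fp; apply/Lfun1_integrable; apply: Lfun_subset fp; rewrite ?lee_fin//.
exact: fin_num_measure.
Qed.

Lemma powR_mul_sub1 (p x : R) : 0 < x -> x `^ p = x * x `^ (p - 1).
Proof.
move=> x0; have nz : (1 + (p - 1) == 0) ==> (x != 0).
  by apply/implyP => _; rewrite gt_eqF.
by rewrite -{1}(subrKC 1 p) (powRD nz) powRr1// ltW.
Qed.

(** For |x| >= e, the right-hand fraction is at least |x|. *)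
Lemma norm_le_powR (p e x : R) : 1 <= p -> 0 < e ->
  `|x| <= e + `|x| `^ p / e `^ (p - 1).
Proof.
move=> p1 e0; have [xe|/ltW ex] := leP `|x| e.
  by rewrite (le_trans xe)// lerDl divr_ge0 ?powR_ge0.
have x0 : 0 < `|x| by exact: lt_le_trans ex.
rewrite (@le_trans _ _ (`|x| `^ p / e `^ (p - 1)))//; last first.
  by rewrite lerDr ltW.
rewrite ler_pdivlMr ?powR_gt0//.
rewrite (powR_mul_sub1 p x0) ler_wpM2l//; apply: ge0_ler_powR;
  rewrite ?nnegrE ?subr_ge0// ltW//.
Qed.

Lemma Lnorm_cvg0_mean (p : R) (h : nat -> Omega -> R) : 1 <= p ->
  (forall n, h n \in Lfun P p%:E) ->
  ('N[P]_(p%:E)[EFin \o h n] @[n --> \oo] --> 0)%E ->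
  forall e : R, 0 < e -> \forall n \near \oo, \int[P]_w `|h n w| <= e.
Proof.
move=> p1 hL h0 e e0; pose c := e / 2.
have e20 : 0 < c by rewrite divr_gt0.
have ec : e = c + c by exact: splitr.
clearbody c; have pN0 : p != 0 by rewrite gt_eqF// (lt_le_trans ltr01).
have small : \forall n \near \oo, ('N[P]_(p%:E)[EFin \o h n] < c%:E)%E.
  have /fine_cvgP[fin0 /cvgr_lt/(_ c e20) lt0] := h0.
  near=> n; have Nfin : ('N[P]_(p%:E)[EFin \o h n])%E \is a fin_num.
    by near: n.
  by rewrite -(fineK Nfin) lte_fin; near: n.
near=> n; have Nc : ('N[P]_(p%:E)[EFin \o h n] < c%:E)%E by near: n.
have ip : P.-integrable setT (EFin \o (fun w => `|h n w| `^ p)).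
  exact: Lfun_integrable.
have i1 := integrable_norm (Lfun_integrable_ge1 p1 (hL n)).
have Ip : \int[P]_w (`|h n w| `^ p) <= c `^ p.
  rewrite -lee_fin /Rintegral fineK ?integrable_fin_num//.
  have -> : (\int[P]_w (`|h n w| `^ p)%:E = 'N[P]_(p%:E)[EFin \o h n] `^ p)%E.
    by rewrite poweR_Lnorm.
  rewrite -poweR_EFin; apply: gt0_ler_poweR; rewrite ?in_itv/= ?leey ?andbT//.
  - exact: le_trans p1.
  - exact: Lnorm_ge0.
  - by rewrite lee_fin ltW.
  - exact: ltW.
have ic : P.-integrable setT (EFin \o (fun=> c)).
  exact: (finite_measure_integrable_cst P c).
have ik : P.-integrable setT
    (EFin \o (fun w => (c `^ (p - 1))^-1 * `|h n w| `^ p)).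
  exact: (integrableZl measurableT _ ip).
have iR : P.-integrable setT
    (EFin \o (fun w => c + (c `^ (p - 1))^-1 * `|h n w| `^ p)).
  exact: (integrableD measurableT ic ik).
apply: (@le_trans _ _ (\int[P]_w (c + (c `^ (p - 1))^-1 * `|h n w| `^ p))).
  apply: le_Rintegral => // w _; rewrite [X in _ + X]mulrC.
  exact: norm_le_powR.
rewrite RintegralD//.
rewrite RintegralZl// [X in X + _](@mean_cst _ _ _ P c) ec lerD//.
rewrite (le_trans (ler_wpM2l _ Ip)) ?invr_ge0 ?powR_ge0//.
by rewrite (powR_mul_sub1 p e20) mulrC mulfK// gt_eqF// powR_gt0.
Unshelve. all: by end_near.
Qed.

End LpToL1.

(** * One Riemann-Stieltjes integration *)

Lemma all_moments_Lfun {d : measure_display} {Omega : measurableType d}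
  {R : realType} (P : probability Omega R) (p : R) (X : Omega -> R) :
  1 <= p -> all_moments P X -> X \in Lfun P p%:E.
Proof.
move=> p1 aX; have p0 : 0 <= p by exact: le_trans p1.
pose n := (Num.truncn p).+1; have pn : p <= n%:R by rewrite ltW// truncnS_gt.
apply: (@Lfun_subset _ _ _ P p%:E n%:R%:E); rewrite ?lee_fin//.
- exact: (le_trans p1).
- exact: fin_num_measure.
rewrite inE; apply/andP; split; rewrite inE/=; first by case: aX.
rewrite /finite_norm unlock; apply: poweR_lty.
have /integrableP[_] := all_moments_integrable (all_momentsX n
  (all_moments_norm aX)).
apply: le_lt_trans; rewrite le_eqVlt; apply/orP; left; apply/eqP.
by apply: eq_integral => w _; rewrite /= exprfctE powR_mulrn// normrX normr_id.
Qed.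

Section IteratedIntegrals.
Context {d : measure_display} {Omega : measurableType d} {R : realType}.
Variables (P : probability Omega R) (p T : R).
Hypotheses (p1 : 1 <= p) (T0 : 0 <= T).
Variable C : set (Omega -> R).
Hypotheses (C_moments : forall X, C X -> all_moments P X)
  (C_cst : forall c : R, 0 <= c -> C (cst c))
  (C_add : forall X Y, C X -> C Y -> C (X + Y))
  (C_mul : forall X Y, C X -> C Y -> C (X * Y))
  (C_mean : forall X, C X -> 0 <= mean P X)
  (C_closed : forall X, all_moments P X -> moment_approx P C X -> C X).

Definition node (l k : nat) : R := k%:R * T / l%:R.

Lemma node_itv l k : (k <= l)%N -> node l k \in `[0, T].
Proof.
rewrite in_itv/= /node; case: l => [|l] kl.
  (* For l = 0 the division by zero yields 0. *)
  by move: kl; rewrite leqn0 => /eqP->; rewrite !mul0r lexx.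
rewrite divr_ge0 ?mulr_ge0//= ler_pdivrMr// mulrC ler_wpM2l// ler_nat//.
Qed.

Lemma node_subinterval_subproof l (k : 'I_l) :
  [&& 0 <= node l k, node l k <= node l k.+1 & node l k.+1 <= T].
Proof.
have /itvP h0 := node_itv (ltnW (ltn_ord k)).
have /itvP h1 := node_itv (ltn_ord k).
rewrite h0 h1 /= andbT /node ler_wpM2r ?invr_ge0// ler_wpM2r// ler_nat//.
Qed.

Definition node_subinterval l (k : 'I_l) : subinterval T :=
  exist _ (node l k, node l k.+1) (node_subinterval_subproof k).

Lemma RS_sumE (f g : R -> Omega -> R) l :
  RS_sum T f g l = \sum_(k < l) f (node l k) * increment g (node_subinterval k).
Proof. by apply/funext => w; rewrite fct_sumE. Qed.

Lemma sum_increment (g : R -> Omega -> R) l :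
  \sum_(k < l.+1) increment g (node_subinterval k) = g T - g 0.
Proof.
rewrite /increment/=; under eq_bigr do rewrite /upper /lower/=.
rewrite -(big_mkord xpredT (fun k => g (node l.+1 k.+1) - g (node l.+1 k))).
rewrite telescope_sumr// /node mul0r mul0r mulrAC divff ?mul1r//.
Qed.

Variable g : R -> Omega -> R.
Hypothesis C_increment : forall i : subinterval T, C (increment g i).

Lemma cone_RS_sum (f : R -> Omega -> R) l :
  (forall u, u \in `[0, T] -> C (f u)) -> C (RS_sum T f g l).
Proof.
move=> Cf; rewrite RS_sumE; apply: cone_sum => // k _; apply: C_mul => //.
by apply: Cf; apply: node_itv; exact: ltnW.
Qed.

Lemma RS_sumB (f f' : R -> Omega -> R) l :
  RS_sum T f' g l - RS_sum T f g l = RS_sum T (fun u => f' u - f u) g l.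
Proof.
by rewrite !RS_sumE -sumrB; apply: eq_bigr => k _; rewrite mulrBl.
Qed.

(** The increments over a subdivision add up to [g T - g 0]; the subdivision
    has to be nonempty. *)
Lemma cone_RS_sum_bound (f : R -> Omega -> R) M l :
  (forall u, u \in `[0, T] -> C (M - f u)) ->
  C (M * (g T - g 0) - RS_sum T f g l.+1).
Proof.
move=> Cf; rewrite -(sum_increment g l) mulr_sumr RS_sumE -sumrB.
apply: cone_sum => // k _; rewrite -mulrBl; apply: C_mul => //.
by apply: Cf; apply: node_itv; exact: ltnW.
Qed.

(** The hypothesis on [f] is what ensures that the Riemann sums are in L^p,
    which the convergence of the norms does not tell. *)
Lemma RS_integral_mean_cvg (f : R -> Omega -> R) I :
  (forall u, u \in `[0, T] -> C (f u)) -> is_RS_integral P p T f g I ->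
  P.-integrable setT (EFin \o I) /\
  forall e : R, 0 < e ->
    \forall l \near \oo, \int[P]_w `|I w - RS_sum T f g l w| <= e.
Proof.
move=> Cf [_ _ LI cvgI]; split; first exact: (Lfun_integrable_ge1 p1).
have LS l : RS_sum T f g l \in Lfun P p%:E.
  by apply: all_moments_Lfun => //; apply: C_moments; exact: cone_RS_sum.
have LD l : (RS_sum T f g l \- I)%R \in Lfun P p%:E.
  have pe1 : (1 <= p%:E)%E by rewrite lee_fin.
  by apply: (@rpredB _ (Lfun P p%:E)) => //.
move=> e e0; have := Lnorm_cvg0_mean p1 LD cvgI e0.
apply: filterS => l; congr (_ <= _).
by apply: eq_Rintegral => w _; rewrite distrC.
Qed.

(** The invariant of the induction on the number of integrations: the Riemann
    sums satisfy the three conditions, with [M * (g T - g 0)] as their bound,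
    and each condition passes to the limit by [cone_limit]. *)
Lemma cone_RS_integral (f f' : R -> Omega -> R) (M I I' : Omega -> R) :
  (forall u, u \in `[0, T] -> [/\ C (f u), C (f' u - f u) & C (M - f' u)]) ->
  is_RS_integral P p T f g I -> is_RS_integral P p T f' g I' ->
  [/\ C I, C (I' - I) & C (M * (g T - g 0) - I')].
Proof.
move=> Cff hI hI'.
have Cf u : u \in `[0, T] -> C (f u) by case/Cff.
have Cd u : u \in `[0, T] -> C (f' u - f u) by case/Cff.
have CM' u : u \in `[0, T] -> C (M - f' u) by case/Cff.
have Cf' u : u \in `[0, T] -> C (f' u).
  by move=> uT; rewrite -(subrK (f u) (f' u)); apply: C_add;
    [exact: Cd|exact: Cf].
have CM u : u \in `[0, T] -> C (M - f u).
  move=> uT; have -> : M - f u = (M - f' u) + (f' u - f u) by rewrite addrA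
    subrK.
  by apply: C_add; [exact: CM'|exact: Cd].
have [iI lI] := RS_integral_mean_cvg Cf hI.
have [iI' lI'] := RS_integral_mean_cvg Cf' hI'.
pose N := M * (g T - g 0).
pose S l := RS_sum T f g l.+1; pose S' l := RS_sum T f' g l.+1.
have CS l : C (S l) by exact: cone_RS_sum.
have CS' l : C (S' l) by exact: cone_RS_sum.
have CNS l : C (N - S l) by exact: cone_RS_sum_bound.
have CNS' l : C (N - S' l) by exact: cone_RS_sum_bound.
have CSS l : C (S' l - S l) by rewrite /S /S' RS_sumB; exact: cone_RS_sum.
have mcS l : P.-integrable setT (EFin \o (fun w => `|I w - S l w|)).
  apply: (integrable_norm (f := fun w => I w - S l w)).
  have iS := all_moments_integrable (C_moments (CS l)).
  exact: (integrableB measurableT iI iS).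
have mcS' l : P.-integrable setT (EFin \o (fun w => `|I' w - S' l w|)).
  apply: (integrable_norm (f := fun w => I' w - S' l w)).
  have iS := all_moments_integrable (C_moments (CS' l)).
  exact: (integrableB measurableT iI' iS).
have CN : C N by rewrite -(subrK (S 0) N); exact: C_add.
have common e : 0 < e -> exists l, \int[P]_w `|I w - S l w| <= e /\
    \int[P]_w `|I' w - S' l w| <= e.
  move=> e0; have [l _ hl] := filterI (lI e e0) (lI' e e0).
  by exists l; have [] := hl l.+1 (leqnSn l).
have lim := cone_limit C_moments C_cst C_add C_mul C_mean C_closed.
split.
- apply: (lim S N) => // e /common[l [h _]]; by exists l.
- apply: (lim (fun l => S' l - S l) N) => //.
  + move=> l; have -> : N - (S' l - S l) = (N - S' l) + S l.
      by rewrite opprB addrA addrAC.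
    exact: C_add.
  + exact: (integrableB measurableT iI' iI).
  + move=> e e0; have e20 : 0 < e / 2 by rewrite divr_gt0.
    have [l [h h']] := common _ e20; exists l.
    have iS : P.-integrable setT
        (EFin \o (fun w => `|I' w - S' l w| + `|I w - S l w|)).
      exact: (integrableD measurableT (mcS' l) (mcS l)).
    rewrite (@le_trans _ _ (\int[P]_w (`|I' w - S' l w| + `|I w - S l w|)))//.
      apply: le_Rintegral => //.
        apply: integrable_dominated iS.
          apply: measurableT_comp => //; apply: measurable_funB.
            apply: measurable_funB; apply/measurable_EFinP.
              exact: measurable_int iI'.
            exact: measurable_int iI.
          by apply: measurable_funB;
            case: (C_moments (CS' l)) (C_moments (CS l)) => ? _ [].
        move=> w; rewrite normr_id !fctE.
        have -> : I' w - I w - (S' l w - S l w) = (I' w - S' l w) - (I w - S l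
          w).
          by ring.
        exact: ler_normB.
      move=> w _; rewrite !fctE.
      have -> : I' w - I w - (S' l w - S l w) = (I' w - S' l w) - (I w - S l w).
        by ring.
      exact: ler_normB.
    by rewrite RintegralD// [e]splitr lerD.
- apply: (lim (fun l => N - S' l) N) => //.
  + by move=> l; rewrite opprB addrC subrK.
  + exact: (integrableB measurableT (all_moments_integrable (C_moments CN))
    iI').
  + move=> e /common[l [_ h]]; exists l; apply: le_trans h.
    rewrite le_eqVlt; apply/orP; left; apply/eqP.
    apply: eq_Rintegral => w _; rewrite !fctE [RHS]distrC; congr `|_|.
    by rewrite /N !fctE; ring.
Qed.

End IteratedIntegrals.

(** * Comparison of iterated integrals *)

Section Comparison.
Context {d : measure_display} {Omega : measurableType d} {R : realType}.
Variables (P : probability Omega R) (p T : R).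
Hypotheses (p1 : 1 <= p) (T0 : 0 <= T).
Variable C : set (Omega -> R).
Hypotheses (C_moments : forall X, C X -> all_moments P X)
  (C_cst : forall c : R, 0 <= c -> C (cst c))
  (C_add : forall X Y, C X -> C Y -> C (X + Y))
  (C_mul : forall X Y, C X -> C Y -> C (X * Y))
  (C_mean : forall X, C X -> 0 <= mean P X)
  (C_closed : forall X, all_moments P X -> moment_approx P C X -> C X).

Lemma cone_iterated_integral r (B : r.-tuple (R -> Omega -> R))
    (F F' : r.-tuple R -> Omega -> R) (M J J' : Omega -> R) :
  (forall j (i : subinterval T), C (increment (tnth B j) i)) ->
  (forall s : r.-tuple R, (forall i, tnth s i \in `[0, T]) ->
     [/\ C (F s), C (F' s - F s) & C (M - F' s)]) ->
  is_iterated_integral P p T B F J -> is_iterated_integral P p T B F' J' ->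
  C J /\ C (J' - J).
Proof.
elim: r B F F' M => [|r ih] B F F' M CB CF.
  by move=> -> ->; have [|] := CF [tuple] _; first by case.
move=> [G [hG hJ]] [G' [hG' hJ']].
apply: (ih [tuple of behead B] G G' (M * (thead B T - thead B 0))) => //.
  by move=> j i; rewrite tnth_behead; exact: CB.
move=> s sT; apply: (cone_RS_integral p1 T0 C_moments C_cst C_add C_mul C_mean
  C_closed (g := thead B) _ _ (hG s sT) (hG' s sT)).
  by move=> i; exact: CB.
move=> u uT; apply: CF => i.
by case: (unliftP ord0 i) => [j ->|->]; rewrite ?tnthS ?tnth0.
Qed.

Hypothesis C_cov : forall X Y, C X -> C Y -> mean P X * mean P Y <= mean P (X *
  Y).

Lemma mean_centered_sqr X : all_moments P X ->
  mean P ((X - cst (mean P X)) ^+ 2) = mean P (X ^+ 2) - mean P X ^+ 2.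
Proof.
move=> aX; have aXX := all_momentsX 2 aX; set m := mean P X.
have -> : (X - cst m) ^+ 2 = X ^+ 2 - (2 * m) *: X + cst (m ^+ 2).
  by apply/funext => w; rewrite !fctE /GRing.scale/=; ring.
have aZ := all_momentsZ (2 * m) aX; have ac := all_moments_cst P (m ^+ 2).
rewrite (meanD (all_momentsB aXX aZ) ac) (meanB aXX aZ) (meanZ _ aX) mean_cst.
by rewrite -/m; ring.
Qed.

(** [J' = J + V] with [V] in the cone, so that its variance is Var J + Var V +
    2 Cov(J, V). *)
Lemma cone_variance_le J J' : C J -> C (J' - J) ->
  mean P ((J - cst (mean P J)) ^+ 2) <= mean P ((J' - cst (mean P J')) ^+ 2).
Proof.
move=> CJ; set V := J' - J => CV; have -> : J' = J + V by rewrite addrC subrK.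
have [aJ aV] := (C_moments CJ, C_moments CV).
have [aJ2 aV2 aJV] := And3 (all_momentsX 2 aJ) (all_momentsX 2 aV)
  (all_momentsM aJ aV).
rewrite !mean_centered_sqr//; last exact: all_momentsD.
have -> : (J + V) ^+ 2 = J ^+ 2 + 2 *: (J * V) + V ^+ 2.
  by apply/funext => w; rewrite !fctE /GRing.scale/=; ring.
have aZ := all_momentsZ 2 aJV.
rewrite (meanD (all_momentsD aJ2 aZ) aV2) (meanD aJ2 aZ) (meanZ _ aJV) (meanD
  aJ aV).
have := C_cov CJ CV; have := C_cov CV CV; rewrite -expr2 -[V * V]expr2.
nra.
Qed.

End Comparison.

Section SimplexInCube.
Context {R : realType}.

Lemma simplex_subset_cube (T a b : R) r : @simplex R T r a b `<=` @cube R r a b.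
Proof.
move=> s [_]; rewrite (path_pairwise le_trans) /= all_rcons pairwise_rcons.
move=> /andP[/andP[_ /allP as_] /andP[/allP sb _]] i; rewrite in_itv/=.
by rewrite as_ ?sb ?mem_tnth.
Qed.

Lemma simplex_union_subset (T : R) r n t :
  @simplex_union R T r n t `<=` @cube_union R r n t.
Proof. by move=> s [k kn /simplex_subset_cube ?]; exists k. Qed.

End SimplexInCube.

Unset Implicit Arguments.

Theorem proposition5p9 (R : realType) (d : measure_display)
  (Omega : measurableType d) (P : probability Omega R)
  (p T : R) (r n : nat) (t : nat -> R)
  (B : r.-tuple (R -> Omega -> R)) (J J' : Omega -> R)
  (hp : 1 <= p) (hr : (0 < r)%N)
  (hB : forall j : 'I_r,
     (exists H : R, 2^-1 < H /\ is_fBm P T H (tnth B j)) \/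
     same_process T (tnth B j) (fun u _ => u))
  (hindep : equal_or_independent P T B)
  (hn : (0 < n)%N) (ht0 : t 0%N = 0) (htn : t n = T)
  (ht : forall k : nat, (k < n)%N -> t k < t k.+1)
  (hJ : is_J P p T B (@simplex_union R T r n t) J)
  (hJ' : is_J P p T B (@cube_union R r n t) J') :
  ('E_P[fun w => (`|centered P J w| ^+ 2)%R]
     <= 'E_P[fun w => (`|centered P J' w| ^+ 2)%R])%E.
Proof.
have T0 : 0 <= T.
  rewrite -htn -ht0; elim: n ht {hn htn hJ hJ'} => // n ih ht.
  rewrite (le_trans (ih _)) ?(ltW (ht _ _))// => k kn.
  by apply: ht; exact: ltnW.
pose D := @monomial_cone _ Omega R T r B; pose C := moment_closure P D.
have D_moments X : D X -> all_moments P X := monomial_cone_all_moments hB (X := X).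
have D_mean X : D X -> 0 <= mean P X := monomial_cone_mean_ge0 hB hindep (X := X).
have D_cov X Y : D X -> D Y -> mean P X * mean P Y <= mean P (X * Y).
  exact: (monomial_cone_cov_ge0 hB hindep).
have C_moments X : C X -> all_moments P X by case.
have C_cst c : 0 <= c -> C (cst c).
  by move=> c0; apply: (moment_closure_sub D_moments); exact: monomial_cone_cst.
have C_add X Y : C X -> C Y -> C (X + Y).
  by apply: (moment_closureD D_moments) => *; exact: monomial_coneD.
have C_mul X Y : C X -> C Y -> C (X * Y).
  by apply: (moment_closureM D_moments) => *; exact: monomial_coneM.
have C_mean X : C X -> 0 <= mean P X by exact: (moment_closure_mean_ge0 D_moments).
have C_cov X Y : C X -> C Y -> mean P X * mean P Y <= mean P (X * Y).
  exact: (moment_closure_cov_ge0 D_moments).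
have C_closed X : all_moments P X -> moment_approx P C X -> C X.
  exact: (moment_closure_closed D_moments).
have C_increment j (i : subinterval T) : C (increment (tnth B j) i).
  by apply: (moment_closure_sub D_moments); exact: monomial_cone_increment.
have [CJ CV] : C J /\ C (J' - J).
  (* Indicators are bounded by 1 and are increasing in the set. *)
  apply: (cone_iterated_integral hp T0 C_moments C_cst C_add C_mul C_mean
    C_closed (M := 1) C_increment _ hJ hJ') => s _.
  have sub : \1_(@simplex_union R T r n t) s <= \1_(@cube_union R r n t) s :> R.
    rewrite !indicE ler_nat; case: (boolP (s \in @simplex_union R T r n t)) => // /set_mem h.
    by rewrite mem_set//; exact: simplex_union_subset h.
  split.
  - by apply: C_cst; rewrite indicE.
  - by apply: (C_cst (_ - _)); rewrite subr_ge0.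
  - by apply: (C_cst (1 - _)); rewrite subr_ge0 indicE; case: (_ \in _).
have aJ' : all_moments P J'.
  by rewrite -(subrK J J'); apply/all_momentsD; exact: C_moments.
have centered_mean X : all_moments P X ->
    ('E_P[fun w => (`|centered P X w| ^+ 2)%R] =
     (mean P ((X - cst (mean P X)) ^+ 2))%:E)%E.
  move=> aX; rewrite -expectation_mean; last first.
    by apply/all_momentsX/all_momentsB => //; exact: all_moments_cst.
  congr ('E_P[_])%E; apply/funext => w.
  by rewrite !fctE /centered real_normK ?num_real// expectation_mean.
rewrite !centered_mean//; last exact: C_moments.
rewrite lee_fin; exact: (cone_variance_le C_moments C_cov).
Qed.
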